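(* Let ${}_SC_R$ be a semidualizing $(S,R)$-bimodule. The class $\mathcal{GP}_{\mathcal{A}_C}(R)$ is special precovering in $\mathrm{Mod}(R)$ in each of the following situations: (i) $\mathcal{A}_C(R)\subseteq \mathcal{GP}_{\mathcal{A}_C}(R)^{\wedge}$; (ii) $\mathrm{pd}(\mathcal{I}_C(R))\le m$ for some integer $m\ge 0$, and $\mathrm{id}(\mathcal{A}_C(R))<\infty$.
   Context: $R$ and $S$ are associative rings with identity; $\mathrm{Mod}(R)$ is the category of left $R$-modules. An $(S,R)$-bimodule ${}_SC_R$ is semidualizing if: (a1) ${}_SC$ admits a resolution by finitely generated projective left $S$-modules; (a2) $C_R$ admits a resolution by finitely generated projective right $R$-modules; (b1) the homothety map $S\to\mathrm{Hom}_{R^{\mathrm{op}}}(C,C)$ is an isomorphism; (b2) the homothety map $R\to\mathrm{Hom}_S(C,C)$ is an isomorphism; (c1) $\mathrm{Ext}^{i}_S(C,C)=0$ for all $i\ge1$; (c2) $\mathrm{Ext}^{i}_{R^{\mathrm{op}}}(C,C)=0$ for all $i\ge 1$. The Auslander class $\mathcal{A}_C(R)$ consists of all $M\in\mathrm{Mod}(R)$ such that: (A1) $\mathrm{Tor}^R_{i}(C,M)=0$ for all $i\ge1$; (A2) $\mathrm{Ext}_S^{i}(C,C\otimes_RM)=0$ for all $i\ge 1$; (A3) the natural map $\mu_M:M\to\mathrm{Hom}_S(C,C\otimes_RM)$, $\mu_M(x)(c)=c\otimes x$, is an isomorphism. $\mathcal{I}_C(R)$ is the class of ($C$-injective) left $R$-modules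 of the form $\mathrm{Hom}_S(C,I)$ with $I$ an injective left $S$-module. For a class $\mathcal{Y}\subseteq\mathrm{Mod}(R)$, $\mathrm{pd}(\mathcal{Y})$ and $\mathrm{id}(\mathcal{Y})$ are the suprema of the projective, respectively injective, dimensions of the modules in $\mathcal{Y}$. $\mathcal{GP}_{\mathcal{A}_C}(R)$ is the class of cycles of exact complexes of projective left $R$-modules which remain exact after applying $\mathrm{Hom}_R(-,A)$ for all $A\in\mathcal{A}_C(R)$. For a class $\mathcal{X}\subseteq\mathrm{Mod}(R)$, $\mathcal{X}^{\wedge}$ is the class of modules $M$ admitting, for some $k\ge 0$, an exact sequence $0\to X_k\to\cdots\to X_0\to M\to 0$ with all $X_i\in\mathcal{X}$. A class $\mathcal{X}\subseteq \mathrm{Mod}(R)$ is special precovering if for every $M\in\mathrm{Mod}(R)$ there is an exact sequence $0\to K\to X\to M\to 0$ with $X\in\mathcal{X}$ and $\mathrm{Ext}^1_R(X',K)=0$ for all $X'\in\mathcal{X}$. *)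

(* Defs.v *)
From HB Require Import structures.
From mathcomp Require Import all_boot all_order all_algebra generic_quotient.
From mathcomp Require Import boolp functions.
From mathcomp Require Import freeg.

Set Implicit Arguments.
Unset Strict Implicit.
Unset Printing Implicit Defensive.

Import GRing.Theory.
Local Open Scope ring_scope.
Local Open Scope quotient_scope.

(* Rings are [pzRingType]s: associative and unital, with 1 = 0 allowed.
   Mod(R) is [lmodType R]; right R-modules are left modules over [R^c]. *)

HB.mixin Record Lmodule_isBimodule (S R : pzRingType) C of GRing.Lmodule S C := {
  ract : C -> R -> C;
  ractA : forall c r r', ract (ract c r) r' = ract c (r * r');
  ract1 : forall c, ract c 1 = c;
  ractDl : forall r, {morph ract^~ r : c c' / c + c'};
  ractDr : forall c, {morph ract c : r r' / r + r'};
  ractZ : forall s c r, ract (s *: c) r = s *: ract c r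
}.

#[short(type="bimodType")]
HB.structure Definition Bimodule (S R : pzRingType) :=
  {C of GRing.Lmodule S C & Lmodule_isBimodule S R C}.

Section BimoduleTheory.
Context (S R : pzRingType) (C : bimodType S R).

Lemma ractB (r : R) (c c' : C) : ract (c - c') r = ract c r - ract c' r.
Proof.
have E : ract (c - c') r + ract c' r = ract c r by rewrite -ractDl subrK.
by rewrite -E addrK.
Qed.

Definition rmod : Type := C.
HB.instance Definition _ := GRing.Zmodule.on rmod.

Definition rmod_scale (r : R^c) (c : rmod) : rmod := ract (c : C) r.

Fact rmod_scaleA (a b : R^c) (c : rmod) :
  rmod_scale a (rmod_scale b c) = rmod_scale (a * b) c.
Proof. exact: ractA. Qed.
Fact rmod_scale1 : left_id 1 rmod_scale.
Proof. exact: ract1. Qed.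
Fact rmod_scaleDr : right_distributive rmod_scale +%R.
Proof. by move=> r c c'; exact: ractDl. Qed.
Fact rmod_scaleDl (c : rmod) : {morph rmod_scale^~ c : a b / a + b}.
Proof. by move=> a b; exact: ractDr. Qed.
HB.instance Definition _ := GRing.Zmodule_isLmodule.Build R^c rmod
  rmod_scaleA rmod_scale1 rmod_scaleDr rmod_scaleDl.

Definition ractl (r : R) : C -> C := fun c => ract c r.
Fact ractl_is_linear r : linear (ractl r).
Proof. by move=> s c c'; rewrite /ractl ractDl ractZ. Qed.
HB.instance Definition _ r :=
  GRing.isLinear.Build S C C _ (ractl r) (ractl_is_linear r).

Definition lactr (s : S) : rmod -> rmod := fun c => s *: (c : C).
Fact lactr_is_linear s : linear (lactr s).
Proof. by move=> r c c'; rewrite /lactr scalerDr -ractZ. Qed.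
HB.instance Definition _ s :=
  GRing.isLinear.Build R^c rmod rmod _ (lactr s) (lactr_is_linear s).

End BimoduleTheory.

Lemma linearP_ext (R : pzRingType) (U V : lmodType R) (f g : {linear U -> V}) :
  f =1 g -> f = g.
Proof.
case: f g => [f [[[f1 f2]] [f3]]] [g [[[g1 g2]] [g3]]] /= /funext efg.
by subst g; rewrite (Prop_irrelevance f1 g1) (Prop_irrelevance f2 g2)
  (Prop_irrelevance f3 g3).
Qed.

(* homS C N is Hom_S(C, N) with the left R-action (r f)(c) = f(cr). *)

Section HomModule.
Context (S R : pzRingType) (C : bimodType S R) (N : lmodType S).

Definition homS : Type := {linear C -> N}.
Definition homS_fun (f : homS) : {linear C -> N} := f.
HB.instance Definition _ := gen_eqMixin homS.
HB.instance Definition _ := gen_choiceMixin homS.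

Definition homS_zero : homS := (\0 : C -> N).
Definition homS_opp (f : homS) : homS := (\- homS_fun f).
Definition homS_add (f g : homS) : homS := (homS_fun f \+ homS_fun g).
Definition homS_scale (r : R) (f : homS) : homS := (homS_fun f \o ractl r).

Fact homS_addA : associative homS_add.
Proof. by move=> f g h; apply: linearP_ext => c; exact: addrA. Qed.
Fact homS_addC : commutative homS_add.
Proof. by move=> f g; apply: linearP_ext => c; exact: addrC. Qed.
Fact homS_add0 : left_id homS_zero homS_add.
Proof. by move=> f; apply: linearP_ext => c; exact: add0r. Qed.
Fact homS_addN : left_inverse homS_zero homS_opp homS_add.
Proof. by move=> f; apply: linearP_ext => c; exact: addNr. Qed.
HB.instance Definition _ :=
  GRing.isZmodule.Build homS homS_addA homS_addC homS_add0 homS_addN.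

Fact homS_scaleA (a b : R) (f : homS) :
  homS_scale a (homS_scale b f) = homS_scale (a * b) f.
Proof. by apply: linearP_ext => c /=; rewrite /ractl ractA. Qed.
Fact homS_scale1 : left_id 1 homS_scale.
Proof. by move=> f; apply: linearP_ext => c /=; rewrite /ractl ract1. Qed.
Fact homS_scaleDr : right_distributive homS_scale +%R.
Proof. by move=> r f g; apply: linearP_ext. Qed.
Fact homS_scaleDl (f : homS) : {morph homS_scale^~ f : a b / a + b}.
Proof.
move=> a b; apply: linearP_ext => c /=.
by rewrite /ractl ractDr (raddfD (homS_fun f)).
Qed.
HB.instance Definition _ := GRing.Zmodule_isLmodule.Build R homS
  homS_scaleA homS_scale1 homS_scaleDr homS_scaleDl.

Lemma homS_addE (f g : homS) c : homS_fun (f + g) c = homS_fun f c + homS_fun g c.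
Proof. by []. Qed.
Lemma homS_scaleE r (f : homS) c : homS_fun (r *: f) c = homS_fun f (ract c r).
Proof. by []. Qed.

End HomModule.

Local Notation "<< p >>" := (Freeg [:: (1, p)]).

Section Tensor.
Context (S R : pzRingType) (C : bimodType S R) (M : lmodType R).

(* The subgroup of the free abelian group on C * M generated by the relations
   of a biadditive R-balanced map. *)
Inductive tensor_rel : {freeg (C * M)%type / int} -> Prop :=
| tensor_rel0 : tensor_rel 0
| tensor_relB x y : tensor_rel x -> tensor_rel y -> tensor_rel (x - y)
| tensor_relDl c c' m : tensor_rel (<<(c + c', m)>> - <<(c, m)>> - <<(c', m)>>)
| tensor_relDr c m m' : tensor_rel (<<(c, m + m')>> - <<(c, m)>> - <<(c, m')>>)
| tensor_relA c (r : R) m : tensor_rel (<<(ract c r, m)>> - <<(c, r *: m)>>).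

Definition tensor_relb : {pred {freeg (C * M)%type / int}} :=
  fun x => `[< tensor_rel x >].
Fact tensor_relb_closed : zmod_closed tensor_relb.
Proof.
split=> [|x y /asboolP rx /asboolP ry]; apply/asboolP; first exact: tensor_rel0.
exact: tensor_relB.
Qed.
HB.instance Definition _ :=
  GRing.isZmodClosed.Build _ tensor_relb tensor_relb_closed.

Definition tensor : Type := Quotient.quot tensor_relb.
HB.instance Definition _ := GRing.Zmodule.on tensor.

Definition tens_pi (x : {freeg (C * M)%type / int}) : tensor :=
  \pi_(Quotient.quot tensor_relb) x.
Definition tens (c : C) (m : M) : tensor := tens_pi <<(c, m)>>.

Fact tens_pi_is_zmod_morphism : zmod_morphism tens_pi.
Proof. by move=> x y; rewrite /tens_pi !piE. Qed.
HB.instance Definition _ :=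
  GRing.isZmodMorphism.Build _ _ tens_pi tens_pi_is_zmod_morphism.

Lemma tens_pi_eq0 x : tensor_rel x -> tens_pi x = 0.
Proof.
move=> rx; rewrite -(raddf0 tens_pi); apply/eqP.
by rewrite -Quotient.idealrBE subr0; apply/asboolP.
Qed.

Lemma tensDl c c' m : tens (c + c') m = tens c m + tens c' m.
Proof.
apply/eqP; rewrite -subr_eq0 opprD addrA /tens -!(raddfB tens_pi).
by apply/eqP; apply: tens_pi_eq0; exact: tensor_relDl.
Qed.

Lemma tensDr c m m' : tens c (m + m') = tens c m + tens c m'.
Proof.
apply/eqP; rewrite -subr_eq0 opprD addrA /tens -!(raddfB tens_pi).
by apply/eqP; apply: tens_pi_eq0; exact: tensor_relDr.
Qed.

Lemma tensA c (r : R) m : tens (ract c r) m = tens c (r *: m).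
Proof.
apply/eqP; rewrite -subr_eq0 /tens -(raddfB tens_pi).
by apply/eqP; apply: tens_pi_eq0; exact: tensor_relA.
Qed.

Lemma freeg_int_ind (K : choiceType) (P : {freeg K / int} -> Prop) :
  P 0 -> (forall x y, P x -> P y -> P (x - y)) -> (forall k, P <<k>>) ->
  forall x, P x.
Proof.
move=> P0 PB P1 x.
have PN y : P y -> P (- y) by rewrite -sub0r; exact: PB.
have PD y z : P y -> P z -> P (y + z).
  by move=> Py Pz; rewrite -[z]opprK; apply/PB/PN.
have Pn k (n : nat) : P (<<k>> *+ n).
  by elim: n => [|n IH]; rewrite ?mulr0n // mulrS; apply: PD.
rewrite -(freeg_sumE x); apply: big_ind => // k _.
have -> : Freeg [:: (coeff k x, k)] = <<k>> *~ (coeff k x).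
  by rewrite freegU_mulz intz.
case: (coeff k x) => n; first exact: Pn.
by rewrite NegzE mulrNz; apply/PN/Pn.
Qed.

Lemma tensor_ind (P : tensor -> Prop) :
  P 0 -> (forall x y, P x -> P y -> P (x - y)) -> (forall c m, P (tens c m)) ->
  forall x, P x.
Proof.
move=> P0 PB P1 x; rewrite -[x]reprK -/(tens_pi _).
elim/freeg_int_ind: (repr x) => [|y z Py Pz|[c m]]; last exact: P1.
  by rewrite raddf0.
by rewrite raddfB; apply: PB.
Qed.

Section Lift.
Context (A : zmodType) (b : C -> M -> A).
Hypothesis bDl : forall c c' m, b (c + c') m = b c m + b c' m.
Hypothesis bDr : forall c m m', b c (m + m') = b c m + b c m'.
Hypothesis bA : forall c (r : R) m, b (ract c r) m = b c (r *: m).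

Let freelift (x : {freeg (C * M)%type / int}) : A :=
  fglift (fun p => b p.1 p.2 : zmodule A) x.

Let freeliftB x y : freelift (x - y) = freelift x - freelift y.
Proof. exact: (lift_is_additive (fun p => b p.1 p.2 : zmodule A) x y). Qed.

Let freeliftU c m : freelift <<(c, m)>> = b c m.
Proof. by rewrite /freelift liftU scale1r. Qed.

Let freelift_rel x : tensor_rel x -> freelift x = 0.
Proof.
elim=> {x} [|x y _ x0 _ y0|c c' m|c m m'|c r m].
- by have := freeliftB 0 0; rewrite !subrr.
- by rewrite freeliftB x0 y0 subrr.
- by rewrite !freeliftB !freeliftU bDl -addrA -opprD subrr.
- by rewrite !freeliftB !freeliftU bDr -addrA -opprD subrr.
- by rewrite !freeliftB !freeliftU bA subrr.
Qed.

Definition tensor_lift (x : tensor) : A := freelift (repr x).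

Lemma tensor_lift_pi x : tensor_lift (tens_pi x) = freelift x.
Proof.
apply/eqP; rewrite -subr_eq0 -freeliftB freelift_rel //; apply/asboolP.
have : (repr (tens_pi x) == x %[mod Quotient.quot tensor_relb]) by rewrite reprK.
by rewrite -Quotient.idealrBE.
Qed.

Lemma tensor_liftE c m : tensor_lift (tens c m) = b c m.
Proof. by rewrite /tens tensor_lift_pi freeliftU. Qed.

Lemma tensor_liftB : zmod_morphism tensor_lift.
Proof.
move=> x y; rewrite -[x]reprK -[y]reprK -!/(tens_pi _) -raddfB !tensor_lift_pi.
exact: freeliftB.
Qed.

Lemma tensor_liftD : {morph tensor_lift : x y / x + y}.
Proof.
move=> x y; have E : tensor_lift (x + y - y) = tensor_lift x by rewrite addrK.
by rewrite -E tensor_liftB subrK.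
Qed.

End Lift.

(* S acts by s (c (x) m) = sc (x) m. *)
Let sb (s : S) (c : C) (m : M) : tensor := tens (s *: c) m.
Let sbDl s c c' m : sb s (c + c') m = sb s c m + sb s c' m.
Proof. by rewrite /sb scalerDr tensDl. Qed.
Let sbDr s c m m' : sb s c (m + m') = sb s c m + sb s c m'.
Proof. by rewrite /sb tensDr. Qed.
Let sbA s c (r : R) m : sb s (ract c r) m = sb s c (r *: m).
Proof. by rewrite /sb -ractZ tensA. Qed.

Definition tensor_scale (s : S) (x : tensor) : tensor :=
  tensor_lift (fun c m => tens (s *: c) m) x.

Let tsE s c m : tensor_scale s (tens c m) = tens (s *: c) m.
Proof. exact: (tensor_liftE (sbDl s) (sbDr s) (sbA s)). Qed.
Let tsB s : zmod_morphism (tensor_scale s).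
Proof. exact: (tensor_liftB (sbDl s) (sbDr s) (sbA s)). Qed.
Let tsD s : {morph tensor_scale s : x y / x + y}.
Proof. exact: (tensor_liftD (sbDl s) (sbDr s) (sbA s)). Qed.
Let ts0 s : tensor_scale s 0 = 0.
Proof. by have := tsB s 0 0; rewrite !subrr. Qed.

Fact tensor_scaleA (a b : S) x :
  tensor_scale a (tensor_scale b x) = tensor_scale (a * b) x.
Proof.
elim/tensor_ind: x => [|x y IHx IHy|c m]; first by rewrite !ts0.
  by rewrite !tsB IHx IHy.
by rewrite !tsE scalerA.
Qed.
Fact tensor_scale1 : left_id 1 tensor_scale.
Proof.
elim/tensor_ind => [|x y IHx IHy|c m]; first by rewrite ts0.
  by rewrite tsB IHx IHy.
by rewrite tsE scale1r.
Qed.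
Fact tensor_scaleDr : right_distributive tensor_scale +%R.
Proof. by move=> s x y; rewrite tsD. Qed.
Fact tensor_scaleDl x : {morph tensor_scale^~ x : a b / a + b}.
Proof.
move=> a b; elim/tensor_ind: x => [|x y IHx IHy|c m]; first by rewrite !ts0 addr0.
  by rewrite !tsB IHx IHy addrACA -opprD.
by rewrite !tsE scalerDl tensDl.
Qed.
HB.instance Definition _ := GRing.Zmodule_isLmodule.Build S tensor
  tensor_scaleA tensor_scale1 tensor_scaleDr tensor_scaleDl.

Lemma tensZ (s : S) c m : s *: tens c m = tens (s *: c) m.
Proof. exact: tsE. Qed.

End Tensor.

Section TensorMap.
Context (S R : pzRingType) (C : bimodType S R) (M N : lmodType R).
Context (f : {linear M -> N}).

Definition tensor_map (x : tensor C M) : tensor C N :=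
  tensor_lift (fun c m => tens c (f m)) x.

Let fb (c : C) (m : M) : tensor C N := tens c (f m).
Let fbDl c c' m : fb (c + c') m = fb c m + fb c' m.
Proof. exact: tensDl. Qed.
Let fbDr c m m' : fb c (m + m') = fb c m + fb c m'.
Proof. by rewrite /fb raddfD tensDr. Qed.
Let fbA c (r : R) m : fb (ract c r) m = fb c (r *: m).
Proof. by rewrite /fb linearZ_LR tensA. Qed.

Lemma tensor_mapE c m : tensor_map (tens c m) = tens c (f m).
Proof. exact: (tensor_liftE fbDl fbDr fbA). Qed.

Let tmB : zmod_morphism tensor_map.
Proof. exact: (tensor_liftB fbDl fbDr fbA). Qed.

Fact tensor_map_is_linear : linear tensor_map.
Proof.
move=> s x y.
rewrite -[LHS]/(tensor_lift fb (s *: x + y)) (tensor_liftD fbDl fbDr fbA).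
rewrite -!/(tensor_map _); congr (_ + _).
have t0 : tensor_map 0 = 0 by have := tmB 0 0; rewrite !subrr.
elim/tensor_ind: x => [|x z IHx IHz|c m]; first by rewrite scaler0 t0 scaler0.
  by rewrite scalerBr !tmB scalerBr IHx IHz.
by rewrite tensZ !tensor_mapE tensZ.
Qed.
HB.instance Definition _ :=
  GRing.isLinear.Build S (tensor C M) (tensor C N) _ tensor_map
    tensor_map_is_linear.

End TensorMap.
Arguments tensor_map {S R} C {M N} f x.

Definition surj (A B : Type) (f : A -> B) : Prop := forall y, exists x, f x = y.

Section HomologicalAlgebra.
Context (R : pzRingType).

Definition projective (P : lmodType R) : Prop :=
  forall (A B : lmodType R) (p : {linear A -> B}) (f : {linear P -> B}),
    surj p -> exists g : {linear P -> A}, forall x, p (g x) = f x.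

Definition injective_module (I : lmodType R) : Prop :=
  forall (A B : lmodType R) (i : {linear A -> B}) (f : {linear A -> I}),
    injective i -> exists g : {linear B -> I}, forall x, g (i x) = f x.

Definition finitely_generated (M : lmodType R) : Prop :=
  exists (n : nat) (e : 'I_n -> M),
    forall x, exists a : 'I_n -> R, x = \sum_(i < n) a i *: e i.

Definition exact_at (A B D : lmodType R)
    (f : {linear A -> B}) (g : {linear B -> D}) : Prop :=
  forall y, g y = 0 <-> exists x, f x = y.

(* ... -> M_2 -> M_1 -> M_0 -> M -> 0 *)
Record resolution (M : lmodType R) := Resolution {
  res_obj :> nat -> lmodType R;
  res_d : forall n, {linear res_obj n.+1 -> res_obj n};
  res_aug : {linear res_obj 0 -> M};
  res_aug_surj : surj res_aug;
  res_exact0 : exact_at (res_d 0) res_aug;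
  res_exact : forall n, exact_at (res_d n.+1) (res_d n)
}.

(* 0 -> M -> M^0 -> M^1 -> M^2 -> ... *)
Record coresolution (M : lmodType R) := Coresolution {
  cores_obj :> nat -> lmodType R;
  cores_d : forall n, {linear cores_obj n -> cores_obj n.+1};
  cores_aug : {linear M -> cores_obj 0};
  cores_aug_inj : injective cores_aug;
  cores_exact0 : exact_at cores_aug (cores_d 0);
  cores_exact : forall n, exact_at (cores_d n) (cores_d n.+1)
}.

Definition projective_resolution (M : lmodType R) (P : resolution M) : Prop :=
  forall n, projective (P n).

Definition injective_coresolution (M : lmodType R) (I : coresolution M) : Prop :=
  forall n, injective_module (I n).

Definition vanishes_above (k : nat) (X : nat -> lmodType R) : Prop :=
  forall n, (k < n)%N -> forall x : X n, x = 0.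

Definition pd_le (M : lmodType R) (m : nat) : Prop :=
  exists P : resolution M, projective_resolution P /\ vanishes_above m P.

Definition id_le (M : lmodType R) (m : nat) : Prop :=
  exists I : coresolution M, injective_coresolution I /\ vanishes_above m I.

(* H^i(Hom(P, N)) = 0, where P_{i+1} -> P_i -> P_{i-1} is part of a resolution
   and P_{-1} = 0. *)
Definition hom_cohomology_zero (M : lmodType R) (P : resolution M)
    (N : lmodType R) (i : nat) : Prop :=
  forall f : {linear P i -> N}, (forall x, f (res_d P i x) = 0) ->
  match i return {linear P i -> N} -> Prop with
  | 0%N => fun f => forall x, f x = 0
  | j.+1 => fun f => exists g : {linear P j -> N}, forall x, f x = g (res_d P j x)
  end f.

(* Ext^i_R(M, N) = 0; projective resolutions exist, see
   [exists_projective_resolution]. *)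
Definition Ext_zero (i : nat) (M N : lmodType R) : Prop :=
  forall P : resolution M, projective_resolution P -> hom_cohomology_zero P N i.

Definition modclass := lmodType R -> Prop.

(* pd(Y) and id(Y) are suprema: pd(Y) <= m holds iff m bounds every member's pd,
   and id(Y) < oo iff some m bounds every member's id. *)
Definition class_pd_le (Y : modclass) (m : nat) : Prop :=
  forall M, Y M -> pd_le M m.
Definition class_id_finite (Y : modclass) : Prop :=
  exists m, forall M, Y M -> id_le M m.

Definition class_hat (X : modclass) : modclass := fun M =>
  exists (k : nat) (P : resolution M),
    (forall n, (n <= k)%N -> X (P n)) /\ vanishes_above k P.

Definition special_precovering (X : modclass) : Prop :=
  forall M : lmodType R,
  exists (K P : lmodType R) (i : {linear K -> P}) (p : {linear P -> M}),
    [/\ injective i, exact_at i p, surj p, X P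
      & forall X', X X' -> Ext_zero 1 X' K].

End HomologicalAlgebra.

Section FreeModule.
Context (R : pzRingType) (T : choiceType).

Definition finsupp : {pred T -> R^o} :=
  fun f => `[< exists s : seq T, forall t, f t != 0 -> t \in s >].

Fact finsupp_closed : subsemimod_closed finsupp.
Proof.
split; first split.
- by apply/asboolP; exists [::] => t /eqP.
- move=> f g /asboolP[s fs] /asboolP[s' gs']; apply/asboolP; exists (s ++ s') => t.
  rewrite mem_cat -[(f + g) t]/(f t + g t).
  have [->|/fs -> //] := eqVneq (f t) 0.
  by rewrite add0r => /gs' ->; rewrite orbT.
- move=> a f /asboolP[s fs]; apply/asboolP; exists s => t /eqP aft.
  by apply/fs/eqP => ft; apply: aft; rewrite -[LHS]/(a * f t) ft mulr0.
Qed.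
HB.instance Definition _ := GRing.isSubmodClosed.Build R (T -> R^o) finsupp
  finsupp_closed.

Record freemod := FreeMod { freemod_fun :> T -> R^o; _ : freemod_fun \in finsupp }.
HB.instance Definition _ := [isSub for freemod_fun].
HB.instance Definition _ := [Choice of freemod by <:].
HB.instance Definition _ := [SubChoice_isSubZmodule of freemod by <:].
HB.instance Definition _ := [SubZmodule_isSubLmodule of freemod by <:].

Section Lift.
Context (V : lmodType R) (v : T -> V).

Let freemod_supp (f : freemod) : exists s : seq T, forall t, f t != 0 -> t \in s.
Proof. by have /asboolP := valP f. Qed.

Definition freemod_lift (f : freemod) : V :=
  \sum_(t <- undup (projT1 (cid (freemod_supp f)))) (f t : R) *: v t.

Lemma freemod_liftE (f : freemod) (s : seq T) :
    uniq s -> (forall t, f t != 0 -> t \in s) ->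
  freemod_lift f = \sum_(t <- s) (f t : R) *: v t.
Proof.
move=> us fs; rewrite /freemod_lift; case: cid => s' /= fs'.
have E r : \sum_(t <- r) (f t : R) *: v t = \sum_(t <- r | f t != 0) (f t : R) *: v t.
  rewrite [RHS]big_mkcond; apply: eq_bigr => t _.
  by case: eqVneq => //= ->; rewrite scale0r.
rewrite !E -big_filter -[RHS]big_filter; apply: perm_big.
apply: uniq_perm; rewrite ?filter_uniq ?undup_uniq // => t.
rewrite !mem_filter mem_undup; case: eqVneq => //= ft0.
by rewrite fs // fs'.
Qed.

Fact freemod_lift_is_linear : linear freemod_lift.
Proof.
move=> a f g; have [[s fs] [s' gs]] := (freemod_supp f, freemod_supp g).
pose r := undup (s ++ s').
have [fr gr] : (forall t, f t != 0 -> t \in r) /\ (forall t, g t != 0 -> t \in r).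
  by split=> t /[dup] => [_ /fs|_ /gs]; rewrite mem_undup mem_cat => ->; rewrite ?orbT.
have hE t : (a *: f + g : freemod) t = a * f t + g t by [].
have hr t : (a *: f + g : freemod) t != 0 -> t \in r.
  rewrite hE; have [->|/fr //] := eqVneq (f t) 0.
  by rewrite mulr0 add0r => /gr.
rewrite (freemod_liftE (undup_uniq _) hr) (freemod_liftE (undup_uniq _) fr).
rewrite (freemod_liftE (undup_uniq _) gr) scaler_sumr -big_split /=.
by apply: eq_bigr => t _; rewrite scalerA -scalerDl.
Qed.
HB.instance Definition _ :=
  GRing.isLinear.Build R freemod V _ freemod_lift freemod_lift_is_linear.
End Lift.

Fact freemod_delta_subproof (t : T) : (fun t' => (t' == t)%:R : R^o) \in finsupp.
Proof.
apply/asboolP; exists [:: t] => t'; rewrite inE.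
by apply: contraNT => /negPf ->; rewrite mulr0n.
Qed.
Definition freemod_delta (t : T) : freemod := FreeMod (freemod_delta_subproof t).

Lemma freemod_lift_delta (V : lmodType R) (v : T -> V) t :
  freemod_lift v (freemod_delta t) = v t.
Proof.
rewrite (@freemod_liftE _ _ _ [:: t]) //.
  by rewrite big_seq1 /= eqxx scale1r.
by move=> t' /=; rewrite inE; apply: contraNT => /negPf ->; rewrite mulr0n.
Qed.

Lemma freemod_sumE (f : freemod) : f = freemod_lift freemod_delta f.
Proof.
have [s fs] : exists s : seq T, forall t, f t != 0 -> t \in s.
  by have /asboolP := valP f.
rewrite (@freemod_liftE _ _ _ (undup s)) ?undup_uniq //; last first.
  by move=> t /fs; rewrite mem_undup.
apply/val_inj; rewrite raddf_sum /=; apply/funext => t.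
rewrite fct_sumE.
have [ts|tns] := boolP (t \in undup s).
  rewrite (bigD1_seq t) ?undup_uniq //= big1 => [|t' t't].
    by rewrite addr0 -[RHS]/(f t * (t == t)%:R) eqxx mulr1.
  by rewrite -[LHS]/(f t' * (t == t')%:R) eq_sym (negPf t't) mulr0.
rewrite big_seq big1 => [|t' t's].
  by apply/eqP; apply: contraNT tns => /fs; rewrite mem_undup.
rewrite -[LHS]/(f t' * (t == t')%:R); case: eqVneq => [e|_]; last by rewrite mulr0.
by rewrite e t's in tns.
Qed.

Lemma freemod_projective : projective freemod.
Proof.
move=> A B p f psurj.
pose a t := projT1 (cid (psurj (f (freemod_delta t)))).
have pa t : p (a t) = f (freemod_delta t) by rewrite /a; case: cid.
exists (freemod_lift a : {linear freemod -> A}) => x.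
rewrite [in RHS](freemod_sumE x) /= /freemod_lift !raddf_sum /=.
by apply: eq_bigr => t _; rewrite !linearZ_LR pa.
Qed.

End FreeModule.

Section Kernel.
Context (R : pzRingType) (A B : lmodType R) (f : {linear A -> B}).

Definition in_ker : {pred A} := fun x => f x == 0.
Fact in_ker_closed : subsemimod_closed in_ker.
Proof.
split; first split; rewrite ?unfold_in /in_ker ?raddf0 //.
  move=> x y; rewrite !unfold_in /in_ker => /eqP fx /eqP fy.
  by rewrite linearD fx fy addr0.
move=> a x; rewrite !unfold_in /in_ker => /eqP fx.
by rewrite linearZ_LR fx scaler0.
Qed.
HB.instance Definition _ := GRing.isSubmodClosed.Build R A in_ker in_ker_closed.

Record kermod := KerMod { kermod_val : A; _ : kermod_val \in in_ker }.
HB.instance Definition _ := [isSub for kermod_val].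
HB.instance Definition _ := [Choice of kermod by <:].
HB.instance Definition _ := [SubChoice_isSubZmodule of kermod by <:].
HB.instance Definition _ := [SubZmodule_isSubLmodule of kermod by <:].

Definition kermod_incl : {linear kermod -> A} := val.

Lemma kermod_exact : exact_at kermod_incl f.
Proof.
move=> y; split=> [fy|[[x xP] <-]]; last exact/eqP.
have yP : y \in in_ker by apply/eqP.
by exists (KerMod yP).
Qed.

End Kernel.

Section EnoughProjectives.
Context (R : pzRingType).

Definition freecover (V : lmodType R) : {linear freemod R V -> V} :=
  freemod_lift id.

Lemma freecover_surj V : surj (freecover V).
Proof. by move=> x; exists (freemod_delta R x); exact: freemod_lift_delta. Qed.

Fixpoint free_syz (M : lmodType R) (n : nat) : lmodType R :=
  if n is k.+1 then kermod (freecover (free_syz M k)) else M.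

Definition free_res_d (M : lmodType R) (n : nat) :
    {linear freemod R (free_syz M n.+1) -> freemod R (free_syz M n)} :=
  kermod_incl _ \o freecover (free_syz M n.+1).

Lemma free_res_exact (M : lmodType R) (n : nat) :
  exact_at (free_res_d M n) (freecover (free_syz M n)).
Proof.
move=> y; split=> [/kermod_exact[x <-]|[x <-]]; last by apply/kermod_exact; eexists.
by have [z <-] := freecover_surj x; exists z.
Qed.

Definition free_resolution (M : lmodType R) : resolution M.
Proof.
apply: (@Resolution R M (fun n => freemod R (free_syz M n)) (free_res_d M)
  (freecover M)).
- exact: freecover_surj.
- exact: (@free_res_exact M 0).
- move=> n y; rewrite -free_res_exact.
  split=> [dy|cy]; last by rewrite -[LHS]/(val (freecover _ y)) cy raddf0.
  by apply: val_inj; rewrite -[LHS]/(free_res_d M n y) dy raddf0.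
Defined.

Lemma exists_projective_resolution (M : lmodType R) :
  exists P : resolution M, projective_resolution P.
Proof. by exists (free_resolution M) => n; exact: freemod_projective. Qed.

End EnoughProjectives.

(* Tor^R_i(C, M) = 0, i.e. H_i(C (x)_R P) = 0 for P a projective resolution
   of M. *)
Definition Tor_zero (S R : pzRingType) (C : bimodType S R) (i : nat)
    (M : lmodType R) : Prop :=
  forall P : resolution M, projective_resolution P ->
  match i with
  | 0%N => surj (tensor_map C (res_d P 0))
  | j.+1 => exact_at (tensor_map C (res_d P j.+1)) (tensor_map C (res_d P j))
  end.

(* The successor n + 1, in a form that reduces on the constructors of [int]. *)
Definition succz (n : int) : int :=
  match n with
  | Posz k => Posz k.+1
  | Negz 0 => Posz 0
  | Negz k.+1 => Negz k
  end.

Lemma succzE n : succz n = n + 1.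
Proof.
case: n => [k|[|k]] //=; first by rewrite -PoszD addn1.
by rewrite !NegzE -[k.+2]addn1 PoszD opprD subrK.
Qed.

Section Complexes.
Context (R : pzRingType).

Record zcomplex := ZComplex {
  zc_obj :> int -> lmodType R;
  zc_d : forall n, {linear zc_obj (succz n) -> zc_obj n}
}.

Definition zc_exact (X : zcomplex) : Prop :=
  forall n, exact_at (zc_d X (succz n)) (zc_d X n).

(* Hom_R(X, A) is exact at Hom_R(X_{n+1}, A), for every n. *)
Definition zc_hom_exact (X : zcomplex) (A : lmodType R) : Prop :=
  forall n (f : {linear X (succz n) -> A}),
    (forall x, f (zc_d X (succz n) x) = 0) <->
    (exists g : {linear X n -> A}, forall x, f x = g (zc_d X n x)).

(* M is isomorphic to the kernel of X_{n+1} -> X_n. *)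
Definition is_cycle (X : zcomplex) (n : int) (M : lmodType R) : Prop :=
  exists i : {linear M -> X (succz n)}, injective i /\ exact_at i (zc_d X n).

Definition GP (A : modclass R) : modclass R := fun M =>
  exists X : zcomplex,
    [/\ forall n, projective (X n), zc_exact X,
        forall N, A N -> zc_hom_exact X N
      & exists n, is_cycle X n M].

End Complexes.

Section Semidualizing.
Context (S R : pzRingType) (C : bimodType S R).

Definition homothetyS (s : S) : {linear rmod C -> rmod C} := lactr s.
Definition homothetyR (r : R) : {linear C -> C} := ractl r.

Definition fg_projective_resolvable (T : pzRingType) (M : lmodType T) : Prop :=
  exists P : resolution M,
    projective_resolution P /\ forall n, finitely_generated (P n).

Record semidualizing : Prop := Semidualizing {
  semidualizing_a1 : fg_projective_resolvable C;
  semidualizing_a2 : fg_projective_resolvable (rmod C);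
  semidualizing_b1 : bijective homothetyS;
  semidualizing_b2 : bijective homothetyR;
  semidualizing_c1 : forall i, (1 <= i)%N -> Ext_zero i C C;
  semidualizing_c2 : forall i, (1 <= i)%N -> Ext_zero i (rmod C) (rmod C)
}.

Section Unit.
Context (M : lmodType R).

Definition tensr (x : M) : C -> tensor C M := fun c => tens c x.
Fact tensr_is_linear x : linear (tensr x).
Proof. by move=> s c c'; rewrite /tensr tensDl tensZ. Qed.
HB.instance Definition _ x :=
  GRing.isLinear.Build S C (tensor C M) _ (tensr x) (tensr_is_linear x).

Definition auslander_mu (x : M) : homS C (tensor C M) := tensr x.
Fact auslander_mu_is_linear : linear auslander_mu.
Proof.
move=> r x y; apply: linearP_ext => c.
by rewrite /= /tensr tensDr -tensA.
Qed.
HB.instance Definition _ :=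
  GRing.isLinear.Build R M (homS C (tensor C M)) _ auslander_mu
    auslander_mu_is_linear.
End Unit.

Record Auslander (M : lmodType R) : Prop := InAuslander {
  Auslander_A1 : forall i, (1 <= i)%N -> Tor_zero C i M;
  Auslander_A2 : forall i, (1 <= i)%N -> Ext_zero i C (tensor C M);
  Auslander_A3 : bijective (@auslander_mu M)
}.

(* "Of the form Hom_S(C, I)" is read up to isomorphism. *)
Definition C_injective : modclass R := fun M =>
  exists (I : lmodType S) (f : {linear M -> homS C I}),
    injective_module I /\ bijective f.

End Semidualizing.

(* Main.v *)
(* Write A for the Auslander class, and B^+ = Hom(B, Q/Z).  Every module in
   GP(A) is projective, so a surjection from a free module is a special precover.

   Let X be an exact complex of projectives that stays exact under Hom(-, N)
   for all N in A, with cycles Z_n.  The module C^+ lies in A: for a resolution Q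
   of C by finitely generated projective right modules,
   Hom_R(C^+, Q^+) = Hom(Q, C)^++, so Ext_R(C^+, C^+) = 0 in positive degrees and
   End_R(C^+) = S^++, and the latter gives C (x) C^+ = S^+, which is injective.
   Exactness of Hom(X, C^+) = (C (x) X)^+ makes C (x) X exact with cycles
   C (x) Z_n.  As the X_n are in A, Hom_S(C, C (x) X) = X is exact too; hence
   Hom_S(C, C (x) Z_n) = Z_n, and Ext^i_S(C, C (x) Z_n) = 0 by dimension shifting,
   so every Z_n is in A.  Then Hom(X, Z_n) is exact and Z_n is a retract of a
   projective X_m. *)
From HB Require Import structures.
From mathcomp Require Import all_boot all_order all_algebra generic_quotient.
From mathcomp Require Import boolp classical_sets.
Require Import Defs.

Set Implicit Arguments.
Unset Strict Implicit.
Unset Printing Implicit Defensive.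

Import GRing.Theory Num.Theory.
Local Open Scope ring_scope.

(** * Subgroups of the integers and the group Q/Z *)

Lemma int_subgroup_principal (I : int -> Prop) :
  I 0 -> (forall x y, I x -> I y -> I (x - y)) ->
  exists n : int, forall k, I k <-> (exists j, k = n * j).
Proof.
move=> I0 IB.
have IN x : I x -> I (- x) by rewrite -sub0r; exact: IB.
have ID x y : I x -> I y -> I (x + y) by move=> Ix /IN Iy; rewrite -[y]opprK; exact: IB.
have IM x (j : int) : I x -> I (x * j).
  move=> Ix; have Ipos (m : nat) : I (x * m%:Z).
    by elim: m => [|m IH]; rewrite ?mulr0 // intS mulrDr mulr1; exact: ID.
  by case: j => m; rewrite ?NegzE ?mulrN; [|apply: IN]; exact: Ipos.
have [[m [m0 Im]]|none] := pselect (exists m : nat, (0 < m)%N /\ I m%:Z).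
  have exm : exists m : nat, (0 < m)%N && `[< I m%:Z >].
    by exists m; rewrite m0; apply/asboolP.
  case: (ex_minnP exm) => n /andP[n0 /asboolP In] nmin.
  exists n%:Z => k; split=> [Ik|[j ->]]; last exact: IM.
  exists (k %/ n)%Z; rewrite {1}(divz_eq k n) mulrC.
  suff -> : (k %% n)%Z = 0 by rewrite addr0.
  have Ir : I (k %% n)%Z by have -> : (k %% n)%Z = k - n%:Z * (k %/ n)%Z;
    [rewrite {2}(divz_eq k n) mulrC addrC addKr|apply: IB => //; exact: IM].
  have nz : n%:Z != 0 by rewrite eqz_nat -lt0n.
  have := modz_ge0 k nz; have := ltz_mod k nz.
  case: (k %% n)%Z Ir => // r Ir rn _; have {rn} rn : (r < n)%N by [].
  apply/eqP; rewrite eqz_nat -leqn0 leqNgt; apply/negP => r0.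
  by have := nmin r; rewrite r0 leqNgt rn => /(_ (asboolT Ir)).
(* Without a positive element the subgroup is zero, so its generator is 0. *)
exists 0 => k; split=> [Ik|[j ->]]; last by rewrite mul0r.
exists 0; rewrite mul0r; apply/eqP; apply: contrapT => k0; apply: none.
exists `|k|%N; split; first by rewrite absz_gt0; apply/negP.
by rewrite abszE; case: (normrEsign k) => _; rewrite normrEsign mulrC; exact: IM.
Qed.

Definition rat_int : {pred rat} := fun x => x \is a Num.int.
Fact rat_int_closed : zmod_closed rat_int.
Proof. by split=> [|x y]; rewrite !unfold_in; [exact: rpred0|exact: rpredB]. Qed.
HB.instance Definition _ := GRing.isZmodClosed.Build _ rat_int rat_int_closed.

Definition QZ : Type := Quotient.quot rat_int.
HB.instance Definition _ := GRing.Zmodule.on QZ.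

Definition to_QZ (x : rat) : QZ := (\pi_(Quotient.quot rat_int) x)%qT.
Fact to_QZ_is_zmod_morphism : zmod_morphism to_QZ.
Proof. by move=> x y; rewrite /to_QZ !piE. Qed.
HB.instance Definition _ :=
  GRing.isZmodMorphism.Build _ _ to_QZ to_QZ_is_zmod_morphism.

Lemma to_QZ_eq0 x : (to_QZ x == 0) = (x \is a Num.int).
Proof. by rewrite -(raddf0 to_QZ) -Quotient.idealrBE subr0. Qed.

Lemma to_QZ_surj : surj to_QZ.
Proof. by move=> d; exists (repr d); rewrite /to_QZ reprK. Qed.

Lemma QZ_divisible (d : QZ) (n : int) : n != 0 -> exists d', d = d' *~ n.
Proof.
have [x <-] := to_QZ_surj d => n0; exists (to_QZ (x / n%:~R)).
by rewrite -raddfMz /= -mulrzr divfK // intr_eq0.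
Qed.

Lemma QZ_torsion (n : int) : n \isn't a GRing.unit ->
  exists d : QZ, d != 0 /\ d *~ n = 0.
Proof.
move=> nu; have [->|n0] := eqVneq n 0.
  (* For n = 0 any nonzero class will do; 1/2 is one. Otherwise the class of 1/n is killed by n, and
     it is nonzero because 1/n is integral only for a unit n. *)
  exists (to_QZ (2%:R^-1)); split => //; rewrite to_QZ_eq0 //.
exists (to_QZ (n%:~R^-1)); split; last first.
  by rewrite -raddfMz /= -mulrzr mulVf ?intr_eq0 //; apply/eqP; rewrite to_QZ_eq0.
rewrite to_QZ_eq0; apply: contra nu => /intrP[m mE].
apply/unitrP; exists m.
have : (m * n)%:~R = 1 :> rat by rewrite rmorphM /= -mE mulVf // intr_eq0.
by move=> /(@intr_inj rat (m * n) 1) nm; rewrite nm mulrC nm.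
Qed.

(** Bundles a function obtained by choice, once its additivity is proved, into a morphism. *)
Lemma additive_exists (U V : zmodType) (f : U -> V) :
  zmod_morphism f -> exists g : {additive U -> V}, g =1 f.
Proof.
move=> fB.
by exists (HB.pack_for {additive U -> V} f (GRing.isZmodMorphism.Build U V f fB)).
Qed.

(** * Q/Z is an injective cogenerator of abelian groups *)

Section Extension.
Variables (B E : zmodType) (v : {additive B -> E}) (f : {additive B -> QZ}).
Hypothesis ker_le : forall b, v b = 0 -> f b = 0.

Local Open Scope classical_set_scope.
Let graph : set (E * QZ) := [set p | exists b, p = (v b, f b)].

(** Graphs of additive maps from a subgroup of E to Q/Z that extend v b |-> f b. For a subgroup of E
    * Q/Z, the last clause says that it is single-valued. *)
Let partial (G : set (E * QZ)) : Prop :=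
  [/\ graph `<=` G, forall p q, G p -> G q -> G (p - q)
    & forall d, G (0, d) -> d = 0].

Let maximal_partial : exists G, partial G /\ forall G', G `<` G' -> ~ partial G'.
Proof.
have pg : partial graph.
  split=> // [_ _ [b ->] [b' ->]|d [b [/esym/ker_le f0 ->]]] //.
  by exists (b - b'); rewrite !raddfB.
have [|G [[G0|pG] mG]] := @Zorn_bigcup (E * QZ)%type
    (fun G => G = set0 \/ partial G).
- move=> F FP Ftot.
  have [[G0 [FG0 G0n]]|none] := pselect (exists G, F G /\ G !=set0); last first.
    left; apply/seteqP; split=> // p [G FG Gp]; apply: none.
    by exists G; split=> //; exists p.
  have pF G p : F G -> G p -> partial G.
    by move=> FG Gp; case: (FP G FG) => // G0'; rewrite G0' in Gp.
  right; split.
  + have [p G0p] := G0n; have [sg _ _] := pF _ _ FG0 G0p.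
    by move=> q /sg; exists G0.
  + move=> p q [G FG Gp] [G' FG' Gq].
    have [GG'|G'G] := Ftot _ _ FG FG'.
      by exists G' => //; have [_ + _] := pF _ _ FG' Gq; apply=> //; exact: GG'.
    by exists G => //; have [_ + _] := pF _ _ FG Gp; apply=> //; exact: G'G.
  + by move=> d [G FG Gd]; have [_ _] := pF _ _ FG Gd; apply.
- rewrite {}G0 in mG; case: (mG graph); last by right.
  rewrite properEneq; split=> //; apply/eqP => g0.
  by have : graph (0, 0); [exists 0; rewrite !raddf0|rewrite -g0].
- by exists G; split=> // G' GG' pG'; apply: (mG G' GG'); right.
Qed.

(** Baer's argument: f descends to v(B), and by divisibility of Q/Z a maximal extension of this map
    is defined on all of E. *)
Lemma QZ_extend : exists h : {additive E -> QZ}, forall b, h (v b) = f b.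
Proof.
have [G [[gG GB Gfun] mG]] := maximal_partial.
have G0 : G 0 by have := gG (0, 0); apply; exists 0; rewrite !raddf0.
have GN p : G p -> G (- p) by rewrite -sub0r; exact: GB.
have GD p q : G p -> G q -> G (p + q).
  by move=> Gp Gq; rewrite -[q]opprK; apply/GB/GN.
have GM p (k : int) : G p -> G (p *~ k).
  move=> Gp; have Gpos (n : nat) : G (p *+ n).
    by elim: n => [|n IH]; rewrite ?mulr0n // mulrS; exact: GD.
  by case: k => n; [exact: Gpos|rewrite NegzE mulrNz; apply/GN/Gpos].
have pairM (a : E) (b : QZ) (k : int) : (a, b) *~ k = (a *~ k, b *~ k).
  have pos (m : nat) : (a, b) *+ m = (a *+ m, b *+ m).
    by elim: m => // m IH; rewrite !mulrS IH.
  by case: k => m; [exact: pos|rewrite NegzE !mulrNz -!pmulrn pos].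
have Guniq x d d' : G (x, d) -> G (x, d') -> d = d'.
  move=> Gd Gd'; apply/eqP; rewrite -subr_eq0; apply/eqP/Gfun.
  by have := GB _ _ Gd Gd'; rewrite /GRing.add /= /add_pair /= subrr.
have Gtot x : exists d, G (x, d).
  apply: contrapT => xG.
  (* The k with k x in the domain of G form a subgroup n Z. Dividing the value of G at n x by n
     gives a value d at x that agrees with G, so adjoining (x, d) contradicts maximality. *)
  have [|y z [d Gd] [d' Gd']|n nP] := @int_subgroup_principal
      (fun k => exists d, G (x *~ k, d)).
  - by exists 0; rewrite mulr0z.
  - by exists (d - d'); rewrite mulrzBr; exact: GB Gd Gd'.
  have [d0 Gd0] : exists d, G (x *~ n, d) by apply/nP; exists 1; rewrite mulr1.
  have [d dE] : exists d, d0 = d *~ n.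
    have [n0|n0] := eqVneq n 0; last exact: QZ_divisible.
    exists 0; rewrite mul0rz; apply: Gfun; have := Gd0.
    by rewrite n0 mulr0z.
  apply: (mG [set p | exists k q, G q /\ p = q + (x, d) *~ k]).
    rewrite properEneq; split; last first.
      by move=> p Gp; exists 0, p; rewrite mulr0z addr0.
    apply/eqP => /seteqP[_ /(_ (x, d))] H; apply: xG; exists d; apply: H.
    by exists 1, 0; rewrite mulr1z add0r.
  split.
  - by move=> p /gG Gp; exists 0, p; rewrite mulr0z addr0.
  - move=> _ _ [k [q [Gq ->]]] [k' [q' [Gq' ->]]]; exists (k - k'), (q - q').
    by split; [exact: GB|rewrite mulrzBr opprD addrACA].
  - move=> d' [k [[y e] [Gq]]].
    rewrite pairM /GRing.add /= /add_pair /= => -[/esym/eqP].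
    rewrite addr_eq0 => /eqP yE ->.
    have [j kE] : exists j, k = n * j.
      apply/nP; exists (- e).
      by have := GN _ Gq; rewrite yE -[X in G X]/(- - _, - _) opprK.
    suff -> : e = - (d *~ k) by rewrite addNr.
    apply: (Guniq y) => //; rewrite yE kE !mulrzA -dE.
    by have := GN _ (GM _ j Gd0); rewrite pairM.
pose h x := projT1 (cid (Gtot x)).
have hE x : G (x, h x) by rewrite /h; case: cid.
have [|g gE] := @additive_exists _ _ h.
  by move=> x y; apply: (Guniq (x - y)) => //; exact: GB (hE x) (hE y).
exists g => b; rewrite gE; apply: (Guniq (v b)) => //.
by apply: gG; exists b.
Qed.

End Extension.

(** If y is not in im u, the k with k y in im u form n Z with n not a unit. Some nonzero d in Q/Z is
    killed by n, and the character of im u + Z y that kills im u and sends y to d extends to B. *)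
Lemma QZ_separates_image (A B : zmodType) (u : {additive A -> B}) (y : B) :
  (forall h : {additive B -> QZ}, (forall a, h (u a) = 0) -> h y = 0) ->
  exists a, u a = y.
Proof.
move=> hy; apply: contrapT => yu.
have [|k l [a ak] [b bl]|n nP] :=
    @int_subgroup_principal (fun k => exists a, u a = y *~ k).
- by exists 0; rewrite mulr0z raddf0.
- by exists (a - b); rewrite mulrzBr raddfB ak bl.
have nu : n \isn't a GRing.unit.
  apply/negP => nu; apply: yu.
  have /nP[a] : exists j, 1 = n * j by exists n^-1; rewrite divrr.
  by rewrite mulr1z; exists a.
have [d [d0 dn]] := QZ_torsion nu.
(* A * Z maps onto im u + Z y, and (a, k) |-> k d vanishes on the kernel of this map. *)
have [v vE] : exists v : {additive (A * int)%type -> B},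
    v =1 (fun p => u p.1 + y *~ p.2).
  by apply: additive_exists => p q /=; rewrite raddfB mulrzBr opprD addrACA.
have [f fE] : exists f : {additive (A * int)%type -> QZ}, f =1 (fun p => d *~ p.2).
  by apply: additive_exists => p q; rewrite mulrzBr.
have [|h hE] := @QZ_extend _ _ v f.
  move=> [a k]; rewrite vE fE /= => /eqP; rewrite addrC addr_eq0 => /eqP ky.
  have /nP[j ->] : exists a, u a = y *~ k by exists (- a); rewrite ky raddfN.
  by rewrite mulrzA dn mul0rz.
have hu a : h (u a) = 0 by have := hE (a, 0); rewrite vE fE /= !mulr0z addr0.
have := hE (0, 1); rewrite vE fE /= raddf0 add0r !mulr1z hy // => /esym/eqP.
by rewrite (negPf d0).
Qed.

Lemma QZ_separates (A : zmodType) (x : A) :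
  (forall g : {additive A -> QZ}, g x = 0) -> x = 0.
Proof.
move=> gx; have [|a <- //] := @QZ_separates_image A A \0 x.
by move=> h _; exact: gx.
Qed.

(** * Linear maps and duality *)

Lemma linear_exists (R : pzRingType) (U V : lmodType R) (f : U -> V) :
  linear f -> exists g : {linear U -> V}, g =1 f.
Proof.
by move=> fL; exists (HB.pack_for {linear U -> V} f (GRing.isLinear.Build R U V _ f fL)).
Qed.

(** The map f u^-1 y: preimages under u are chosen arbitrarily, and f does not see the choice.
    Taking y = id gives [linear_factor]; taking f = id gives [linear_corestrict]. *)
Lemma linear_through (R : pzRingType) (A B E N : lmodType R)
    (u : {linear A -> B}) (f : {linear A -> N}) (y : {linear E -> B}) :
  (forall a, u a = 0 -> f a = 0) -> (forall e, exists a, u a = y e) ->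
  exists g : {linear E -> N}, forall e a, u a = y e -> g e = f a.
Proof.
move=> uf uy; pose a e := projT1 (cid (uy e)).
have aE e : u (a e) = y e by rewrite /a; case: cid.
have ff x x' : u x = u x' -> f x = f x'.
  move=> xx'; apply/eqP; rewrite -subr_eq0 -linearB.
  apply/eqP; apply: uf.
  by rewrite linearB xx' subrr.
have [|g gE] := @linear_exists R E N (fun e => f (a e)).
  move=> r e e'; rewrite -linearZ_LR -linearD; apply: ff.
  by rewrite linearD linearZ_LR !aE linearD linearZ_LR.
by exists g => e x ux; rewrite gE; apply: ff; rewrite aE.
Qed.

Lemma linear_factor (R : pzRingType) (A B N : lmodType R)
    (u : {linear A -> B}) (f : {linear A -> N}) :
  surj u -> (forall a, u a = 0 -> f a = 0) ->
  exists g : {linear B -> N}, forall a, g (u a) = f a.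
Proof.
move=> us uf; have [//|g gE] := @linear_through _ _ _ _ _ u f idfun uf.
by exists g => a; exact: gE.
Qed.

Lemma linear_corestrict (R : pzRingType) (A B E : lmodType R)
    (u : {linear A -> B}) (y : {linear E -> B}) :
  injective u -> (forall e, exists a, u a = y e) ->
  exists g : {linear E -> A}, forall e, u (g e) = y e.
Proof.
move=> ui uy; have [|g gE] := @linear_through _ _ _ _ _ u idfun y _ uy.
  by move=> a; rewrite -(raddf0 u) => /ui.
by exists g => e; have [a ae] := uy e; rewrite (gE e a ae).
Qed.

(** Both u and y corestrict to ker v, and by exactness u is onto ker v. *)
Lemma projective_lift (R : pzRingType) (P A B E : lmodType R)
    (u : {linear A -> B}) (v : {linear B -> E}) (y : {linear P -> B}) :
  projective P -> exact_at u v -> (forall x, v (y x) = 0) ->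
  exists g : {linear P -> A}, forall x, u (g x) = y x.
Proof.
move=> Pproj uv vy.
have ki : injective (kermod_incl v) by exact: val_inj.
have [|u' u'E] := @linear_corestrict _ _ _ _ (kermod_incl v) u ki.
  by move=> a; apply/kermod_exact/uv; exists a.
have [|y' y'E] := @linear_corestrict _ _ _ _ (kermod_incl v) y ki.
  by move=> x; apply/kermod_exact.
have [|g gE] := Pproj _ _ u' y'.
  move=> k; have /uv[a ak] : v (kermod_incl v k) = 0.
    by apply/(kermod_exact v); exists k.
  by exists a; apply: ki; rewrite u'E.
by exists g => x; rewrite -u'E gE y'E.
Qed.

Lemma additiveP_ext (U V : zmodType) (f g : {additive U -> V}) : f =1 g -> f = g.
Proof.
case: f g => [f [[f1]]] [g [[g1]]] /= /funext efg; subst g.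
by rewrite (Prop_irrelevance f1 g1).
Qed.

Section Dual.
Variable X : zmodType.

Definition dual : Type := {additive X -> QZ}.
Definition dual_fun (f : dual) : {additive X -> QZ} := f.
HB.instance Definition _ := gen_eqMixin dual.
HB.instance Definition _ := gen_choiceMixin dual.

Definition dual_zero : dual := (\0 : X -> QZ).
Definition dual_opp (f : dual) : dual := (\- dual_fun f).
Definition dual_add (f g : dual) : dual := (dual_fun f \+ dual_fun g).

Fact dual_addA : associative dual_add.
Proof. by move=> f g h; apply: additiveP_ext => x; exact: addrA. Qed.
Fact dual_addC : commutative dual_add.
Proof. by move=> f g; apply: additiveP_ext => x; exact: addrC. Qed.
Fact dual_add0 : left_id dual_zero dual_add.
Proof. by move=> f; apply: additiveP_ext => x; exact: add0r. Qed.
Fact dual_addN : left_inverse dual_zero dual_opp dual_add.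
Proof. by move=> f; apply: additiveP_ext => x; exact: addNr. Qed.
HB.instance Definition _ :=
  GRing.isZmodule.Build dual dual_addA dual_addC dual_add0 dual_addN.
End Dual.

Section DualModule.
Variables (R : pzRingType) (Q : lmodType R^c).

Definition dualmod : Type := dual Q.
HB.instance Definition _ := GRing.Zmodule.on dualmod.

Definition dualmod_scale (r : R) (f : dualmod) : dualmod :=
  dual_fun f \o ( *:%R (r : R^c)).

Fact dualmod_scaleA (a b : R) (f : dualmod) :
  dualmod_scale a (dualmod_scale b f) = dualmod_scale (a * b) f.
Proof. by apply: additiveP_ext => x /=; rewrite scalerA. Qed.
Fact dualmod_scale1 : left_id 1 dualmod_scale.
Proof. by move=> f; apply: additiveP_ext => x /=; rewrite scale1r. Qed.
Fact dualmod_scaleDr : right_distributive dualmod_scale +%R.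
Proof. by move=> r f g; apply: additiveP_ext. Qed.
Fact dualmod_scaleDl (f : dualmod) : {morph dualmod_scale^~ f : a b / a + b}.
Proof.
by move=> a b; apply: additiveP_ext => x /=; rewrite scalerDl (raddfD (dual_fun f)).
Qed.
HB.instance Definition _ := GRing.Zmodule_isLmodule.Build R dualmod
  dualmod_scaleA dualmod_scale1 dualmod_scaleDr dualmod_scaleDl.
End DualModule.

Section Hom.
Variables (R : pzRingType) (U V : lmodType R).

(** Only an abelian group, since R may be noncommutative. *)
Definition hom : Type := {linear U -> V}.
Definition hom_fun (f : hom) : {linear U -> V} := f.
HB.instance Definition _ := gen_eqMixin hom.
HB.instance Definition _ := gen_choiceMixin hom.

Definition hom_zero : hom := (\0 : U -> V).
Definition hom_opp (f : hom) : hom := (\- hom_fun f).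
Definition hom_add (f g : hom) : hom := (hom_fun f \+ hom_fun g).

Fact hom_addA : associative hom_add.
Proof. by move=> f g h; apply: linearP_ext => x; exact: addrA. Qed.
Fact hom_addC : commutative hom_add.
Proof. by move=> f g; apply: linearP_ext => x; exact: addrC. Qed.
Fact hom_add0 : left_id hom_zero hom_add.
Proof. by move=> f; apply: linearP_ext => x; exact: add0r. Qed.
Fact hom_addN : left_inverse hom_zero hom_opp hom_add.
Proof. by move=> f; apply: linearP_ext => x; exact: addNr. Qed.
HB.instance Definition _ :=
  GRing.isZmodule.Build hom hom_addA hom_addC hom_add0 hom_addN.
End Hom.

(** * Duality between the tensor product and maps into the character module *)

Section TensorDuality.
Variables (S R : pzRingType) (C : bimodType S R).
Local Notation "C ^+" := (dualmod (rmod C)) (at level 2).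

(** One direction of the adjunction Hom_R(N, C^+) = (C (x) N)^+; [tensor_dual_out] is the other. *)
Lemma tensor_dual_in (N : lmodType R) (psi : {linear N -> C^+}) :
  exists chi : {additive tensor C N -> QZ},
    forall c x, chi (tens c x) = dual_fun (psi x) c.
Proof.
pose b (c : C) x := dual_fun (psi x) c.
have bDl c c' m : b (c + c') m = b c m + b c' m by exact: raddfD.
have bDr c m m' : b c (m + m') = b c m + b c m' by rewrite /b raddfD.
have bA c (r : R) m : b (ract c r) m = b c (r *: m) by rewrite /b linearZ_LR.
have [|chi chiE] := @additive_exists (tensor C N) QZ (tensor_lift b).
  exact: tensor_liftB.
by exists chi => c x; rewrite chiE tensor_liftE.
Qed.

Lemma tensor_dual_out (N : lmodType R) (chi : {additive tensor C N -> QZ}) :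
  exists psi : {linear N -> C^+}, forall c x, dual_fun (psi x) c = chi (tens c x).
Proof.
have chiB x : zmod_morphism (fun c : rmod C => chi (tens (c : C) x)).
  move=> c c'; apply/eqP; rewrite eq_sym subr_eq -raddfD -tensDl.
  by rewrite subrK.
pose psi x : C^+ := projT1 (cid (additive_exists (chiB x))).
have psiE x c : dual_fun (psi x) c = chi (tens c x) by rewrite /psi; case: cid.
have [|g gE] := @linear_exists _ N C^+ psi.
  move=> r x y; apply: additiveP_ext => c.
  rewrite -[RHS]/(dual_fun (psi x) (ract c r) + dual_fun (psi y) c).
  by rewrite -[LHS]/(dual_fun _ c) !psiE tensDr raddfD -tensA.
by exists g => c x; rewrite gE psiE.
Qed.

Lemma tens0l (M : lmodType R) (m : M) : tens (0 : C) m = 0.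
Proof. by rewrite -[0](scale0r (0 : C)) -tensZ scale0r. Qed.

Lemma tensBl (M : lmodType R) (m : M) (c c' : C) :
  tens (c - c') m = tens c m - tens c' m.
Proof. by rewrite -scaleN1r tensDl -tensZ scaleN1r. Qed.

Lemma tens0r (M : lmodType R) (c : C) : tens c (0 : M) = 0.
Proof. by apply: (addIr (tens c 0)); rewrite -tensDr !add0r. Qed.

Lemma tens_sumr (M : lmodType R) (c : C) (I : Type) (r : seq I) (F : I -> M) :
  tens c (\sum_(i <- r) F i) = \sum_(i <- r) tens c (F i).
Proof. by apply: (big_morph (fun x => tens c x)) => [x y|]; rewrite ?tensDr ?tens0r. Qed.

Lemma tensor_map_surj (A B : lmodType R) (u : {linear A -> B}) :
  surj u -> surj (tensor_map C u).
Proof.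
move=> us; elim/tensor_ind => [|_ _ [x <-] [y <-]|c m]; first by exists 0; rewrite raddf0.
  by exists (x - y); rewrite raddfB.
by have [a <-] := us m; exists (tens c a); rewrite tensor_mapE.
Qed.

Lemma tensor_map_comp0 (A B E : lmodType R) (f : {linear A -> B})
    (g : {linear B -> E}) : (forall x, g (f x) = 0) ->
  forall x, tensor_map C g (tensor_map C f x) = 0.
Proof.
move=> gf; elim/tensor_ind => [|x y IHx IHy|c m]; first by rewrite !raddf0.
  by rewrite !linearB /= IHx IHy subrr.
by rewrite !tensor_mapE gf tens0r.
Qed.

(* The Q/Z-dual of C (x) N is Hom_R(N, C^+). *)
Lemma tensor_exact (A B E : lmodType R) (f : {linear A -> B})
    (g : {linear B -> E}) :
  (forall x, g (f x) = 0) ->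
  (forall psi : {linear B -> C^+}, (forall a, psi (f a) = 0) ->
    exists psi' : {linear E -> C^+}, forall b, psi b = psi' (g b)) ->
  exact_at (tensor_map C f) (tensor_map C g).
Proof.
move=> gf ext y; split=> [gy|[x <-]]; last exact: tensor_map_comp0.
(* A character chi killing the image of C (x) f corresponds to a map B -> C^+ killing im f. The
   hypothesis factors it through g, so chi factors through C (x) g, which kills y. *)
apply: QZ_separates_image => chi chif.
have [psi psiE] := tensor_dual_out chi.
have [a|psi' psi'E] := ext psi.
  by apply: additiveP_ext => c; rewrite psiE -tensor_mapE chif.
have [chi' chi'E] := tensor_dual_in psi'.
suff -> : chi y = chi' (tensor_map C g y) by rewrite gy raddf0.
elim/tensor_ind: y {gy} => [|x y IHx IHy|c m]; first by rewrite !raddf0.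
  by rewrite linearB !raddfB /= IHx IHy.
by rewrite tensor_mapE chi'E -psi'E psiE.
Qed.

End TensorDuality.

(** * Dual bases and comparison of projective resolutions *)

Section DualBasis.
Variables (T : pzRingType) (P : lmodType T).
Hypothesis P_proj : projective P.

(** The functionals are the coordinates of a section of the surjection T^n -> P given by
    generators. *)
Lemma fg_dual_basis : finitely_generated P ->
  exists n (e : 'I_n -> P) (th : 'I_n -> {linear P -> T^o}),
    forall p, p = \sum_(i < n) (th i p : T) *: e i.
Proof.
move=> [n [e eP]].
have [|g gE] := @linear_exists T {ffun 'I_n -> T^o} P
    (fun a => \sum_(i < n) (a i : T) *: e i).
  move=> r a b; rewrite scaler_sumr -big_split /=; apply: eq_bigr => i _.
  by rewrite scalerA -scalerDl !ffunE.
have [|s sE] := P_proj (p := g) (idfun : {linear P -> P}).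
  move=> p; have [a ->] := eP p; exists [ffun i => a i].
  by rewrite gE; apply: eq_bigr => i _; rewrite ffunE.
have thP i : exists t : {linear P -> T^o}, t =1 (fun p => s p i).
  by apply: linear_exists => r p q; rewrite linearP !ffunE.
exists n, e, (fun i => projT1 (cid (thP i))) => p.
rewrite -[LHS](sE p) gE; apply: eq_bigr => i _.
by case: cid => t /= ->.
Qed.

(** A section of the free cover of P, whose basis is indexed by P itself. Any list r containing the
    support is allowed, so that several elements can be expanded over one list. *)
Lemma dual_basis : exists th : P -> {linear P -> T^o},
  (forall p, exists r : seq P, forall t, th t p != 0 -> t \in r) /\
  (forall p (r : seq P), uniq r -> (forall t, th t p != 0 -> t \in r) ->
    p = \sum_(t <- r) (th t p : T) *: t).
Proof.
have [s sE] := P_proj (idfun : {linear P -> P}) (@freecover_surj T P).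
have thP t : exists h : {linear P -> T^o}, h =1 (fun p => s p t).
  by apply: linear_exists => r p q; rewrite linearP.
exists (fun t => projT1 (cid (thP t))).
have thE t p : projT1 (cid (thP t)) p = s p t by case: cid.
split=> [p|p r ur pr].
  have /asboolP[r rP] := valP (s p); exists r => t; rewrite thE; exact: rP.
rewrite -[LHS](sE p) /= (@freemod_liftE _ _ _ _ (s p) r) //.
  by apply: eq_bigr => t _; rewrite thE.
by move=> t; rewrite -thE; exact: pr.
Qed.

End DualBasis.

Section Comparison.
Variable R : pzRingType.

Lemma res_d_comp0 (M : lmodType R) (P : resolution M) n x :
  res_d P n (res_d P n.+1 x) = 0.
Proof. by apply/res_exact; exists x. Qed.

Lemma res_aug_comp0 (M : lmodType R) (P : resolution M) x :
  res_aug P (res_d P 0 x) = 0.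
Proof. by apply/res_exact0; exists x. Qed.

Section Syzygy.
Variables (M : lmodType R) (P : resolution M).

Definition syzygy := kermod (res_aug P).
Definition syz_incl : {linear syzygy -> P 0%N} := kermod_incl (res_aug P).

Lemma syz_incl_inj : injective syz_incl. Proof. exact: val_inj. Qed.

Lemma res_aug_syz x : res_aug P (syz_incl x) = 0.
Proof. by apply/kermod_exact; exists x. Qed.

Fact syz_aug_subproof : exists a : {linear P 1%N -> syzygy},
  forall x, syz_incl (a x) = res_d P 0 x.
Proof.
apply: linear_corestrict; first exact: syz_incl_inj.
by move=> x; apply/kermod_exact/res_exact0; exists x.
Qed.
Definition syz_aug : {linear P 1%N -> syzygy} := projT1 (cid syz_aug_subproof).
Lemma syz_augE x : syz_incl (syz_aug x) = res_d P 0 x.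
Proof. by rewrite /syz_aug; case: cid. Qed.

Lemma syz_aug_surj : surj syz_aug.
Proof.
move=> k; have /res_exact0[x xk] : res_aug P (syz_incl k) = 0 by exact: res_aug_syz.
by exists x; apply: syz_incl_inj; rewrite syz_augE.
Qed.

Lemma syz_exact0 : exact_at (res_d P 1) syz_aug.
Proof.
move=> y; rewrite -(@res_exact _ _ P 0 y); split=> [y0|dy].
  by rewrite -syz_augE y0 linear0.
by apply: syz_incl_inj; rewrite syz_augE dy linear0.
Qed.

Definition syz_resolution : resolution syzygy :=
  @Resolution R syzygy (fun n => P n.+1) (fun n => res_d P n.+1) syz_aug
    syz_aug_surj syz_exact0 (fun n => @res_exact R M P n.+1).

(** Dimension shifting, true by computation: in these degrees both sides involve the same terms and
    differentials. *)
Lemma syz_cohomology (N : lmodType R) n :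
  hom_cohomology_zero syz_resolution N n.+1 <-> hom_cohomology_zero P N n.+2.
Proof. by []. Qed.

End Syzygy.

(* M is a retract of M' in the stable category, i.e. modulo maps that factor
   through a projective; this passes to syzygies, which compares resolutions. *)
Definition stable_retract (M M' : lmodType R) : Prop :=
  exists (phi : {linear M -> M'}) (psi : {linear M' -> M}) (F : lmodType R)
      (a : {linear M -> F}) (b : {linear F -> M}),
    projective F /\ forall x, psi (phi x) = x + b (a x).

Lemma stable_retract_syzygy (M M' : lmodType R) (P : resolution M)
    (P' : resolution M') :
  projective_resolution P -> projective_resolution P' -> stable_retract M M' ->
  exists (phi0 : {linear P 0%N -> P' 0%N}) (phi : {linear syzygy P -> syzygy P'})
      (psi : {linear syzygy P' -> syzygy P}) (b : {linear P 0%N -> syzygy P}),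
    (forall x, syz_incl P' (phi x) = phi0 (syz_incl P x)) /\
    (forall x, psi (phi x) = x + b (syz_incl P x)).
Proof.
move=> Pp Pp' [phi [psi [F [a [b [Fp phiE]]]]]].
have [phi0 phi0E] := Pp 0%N _ _ _ (phi \o res_aug P) (@res_aug_surj _ _ P').
have [psi0 psi0E] := Pp' 0%N _ _ _ (psi \o res_aug P') (@res_aug_surj _ _ P).
have [b0 b0E] := Fp _ _ _ b (@res_aug_surj _ _ P).
have [|phiK phiKE] := linear_corestrict (y := phi0 \o syz_incl P)
    (@syz_incl_inj _ P').
  move=> x; apply/kermod_exact; rewrite /= phi0E /=.
  by rewrite res_aug_syz linear0.
have [|psiK psiKE] := linear_corestrict (y := psi0 \o syz_incl P')
    (@syz_incl_inj _ P).
  move=> x; apply/kermod_exact; rewrite /= psi0E /=.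
  by rewrite res_aug_syz linear0.
(* The defect of the lifts, psi0 phi0 - id - b0 a aug, lands in the syzygy. On the syzygy the last
   term dies, so there psi phi - id factors through the projective P_0. *)
have [|b' b'E] := linear_corestrict
    (y := (psi0 \o phi0) \- idfun \- (b0 \o a \o res_aug P)) (@syz_incl_inj _ P).
  move=> x; apply/kermod_exact.
  by rewrite /= !linearB /= psi0E /= phi0E /= b0E phiE addrAC addrK subrr.
have {}phiKE x : syz_incl P' (phiK x) = phi0 (syz_incl P x) by exact: phiKE.
have {}psiKE x : syz_incl P (psiK x) = psi0 (syz_incl P' x) by exact: psiKE.
have {}b'E x : syz_incl P (b' x) = psi0 (phi0 x) - x - b0 (a (res_aug P x)).
  exact: b'E.
exists phi0, phiK, psiK, b'; split=> // x; apply: syz_incl_inj.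
rewrite linearD b'E psiKE phiKE res_aug_syz (linear0 a) (linear0 b0) subr0.
by rewrite addrC subrK.
Qed.

Lemma hom_cohomology_stable_retract (N : lmodType R) (i : nat) :
  forall (M M' : lmodType R) (P : resolution M) (P' : resolution M'),
    projective_resolution P -> projective_resolution P' -> stable_retract M M' ->
  hom_cohomology_zero P' N i.+1 -> hom_cohomology_zero P N i.+1.
Proof.
elim: i => [|i IH] M M' P P' Pp Pp' MM'; last first.
  have [phi0 [phi [psi [b [_ phiE]]]]] := stable_retract_syzygy Pp Pp' MM'.
  rewrite -2!syz_cohomology; apply: IH => [n|n|]; [exact: Pp|exact: Pp'|].
  by exists phi, psi, (P 0%N), (syz_incl P), b.
(* In degree 1 a cocycle is a map f0 on the syzygy, to be extended to P_0. Since f0 psi extends to g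
   on P'_0, the map g phi0 - f0 b extends f0. *)
have [phi0 [phi [psi [b [phi0E phiE]]]]] := stable_retract_syzygy Pp Pp' MM'.
move=> P'N f fd.
have [|f0 f0E] := linear_factor (f := f) (@syz_aug_surj _ P).
  by move=> x /syz_exact0[y <-].
have [|g gE] := P'N (f0 \o psi \o syz_aug P').
  move=> x /=; have -> : syz_aug P' (res_d P' 1 x) = 0.
    by apply/syz_exact0; exists x.
  by rewrite !linear0.
exists ((g \o phi0) \- (f0 \o b \o idfun)) => x.
have [y yE] := syz_aug_surj (phi (syz_aug P x)).
rewrite /= -syz_augE -phi0E -yE syz_augE -gE /= yE phiE linearD f0E.
by rewrite addrK.
Qed.

(** A single resolution decides the vanishing of Ext, because M is a stable retract of itself. *)
Lemma Ext_zero_resolution (M N : lmodType R) (i : nat) (P : resolution M) :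
  projective_resolution P -> hom_cohomology_zero P N i.+1 -> Ext_zero i.+1 M N.
Proof.
move=> Pp PN Q Qp; apply: (hom_cohomology_stable_retract Qp Pp) => //.
exists idfun, idfun, (freemod R M), \0, \0; split; first exact: freemod_projective.
by move=> x /=; rewrite addr0.
Qed.

End Comparison.

(** * The character module of C *)

Section DualMap.
Variables (X Y : zmodType) (u : {additive X -> Y}).
Definition dual_map (f : dual Y) : dual X := dual_fun f \o u.
Fact dual_map_is_zmod_morphism : zmod_morphism dual_map.
Proof. by move=> f g; apply: additiveP_ext. Qed.
HB.instance Definition _ :=
  GRing.isZmodMorphism.Build _ _ dual_map dual_map_is_zmod_morphism.
End DualMap.

Section DualModMap.
Variables (R : pzRingType) (X Y : lmodType R^c) (u : {linear X -> Y}).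
Definition dualmod_map (f : dualmod Y) : dualmod X := dual_map u f.
Fact dualmod_map_is_linear : linear dualmod_map.
Proof. by move=> r f g; apply: additiveP_ext => x /=; rewrite linearZ_LR. Qed.
HB.instance Definition _ :=
  GRing.isLinear.Build R (dualmod Y) (dualmod X) _ dualmod_map dualmod_map_is_linear.
End DualModMap.

Section HomMap.
Variables (R : pzRingType) (X Y V : lmodType R) (u : {linear X -> Y}).
Definition hom_map (f : hom Y V) : hom X V := hom_fun f \o u.
Fact hom_map_is_zmod_morphism : zmod_morphism hom_map.
Proof. by move=> f g; apply: linearP_ext. Qed.
HB.instance Definition _ :=
  GRing.isZmodMorphism.Build _ _ hom_map hom_map_is_zmod_morphism.
End HomMap.
Arguments hom_map {R X Y} V u f.

(** Exactness of the double dual, by using the injectivity of Q/Z twice: a character of B killed by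
    u^+ comes from E, so alpha kills it, and alpha then extends along u^+. *)
Lemma bidual_exact (A B E : zmodType) (u : {additive A -> B})
    (v : {additive B -> E}) (alpha : {additive dual B -> QZ}) :
  (forall b, v b = 0 -> exists a, u a = b) ->
  (forall xi : dual E, alpha (dual_map v xi) = 0) ->
  exists beta : {additive dual A -> QZ}, forall chi, alpha chi = beta (dual_map u chi).
Proof.
move=> uv av.
have [|beta betaE] := QZ_extend (v := dual_map u) (f := alpha); last first.
  by exists beta => chi; rewrite betaE.
move=> chi chiu.
have [|xi xiE] := QZ_extend (v := v) (f := dual_fun chi).
  by move=> b /uv[a <-]; rewrite -[LHS]/(dual_fun (dual_map u chi) a) chiu.
by rewrite -(av xi); congr (alpha _); apply: additiveP_ext => b; rewrite -[LHS]xiE.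
Qed.

Section Evaluation.
Variables (S R : pzRingType) (C : bimodType S R).
Local Notation "C ^+" := (dualmod (rmod C)) (at level 2).

(** The image of q (x) f under the evaluation map from Q (x)_R C^+ to Hom(Q, C)^+. *)
Definition hom_eval (Q : lmodType R^c) (f : C^+) (q : Q) : dual (hom Q (rmod C)) :=
  projT1 (cid (@additive_exists (hom Q (rmod C)) QZ
    (fun h => dual_fun f (hom_fun h q)) (fun h h' => raddfB (dual_fun f) _ _))).

Lemma hom_evalE (Q : lmodType R^c) f (q : Q) h :
  dual_fun (hom_eval f q) h = dual_fun f (hom_fun h q).
Proof. by rewrite /hom_eval; case: cid. Qed.

Lemma hom_eval_map (Q Q' : lmodType R^c) (u : {linear Q -> Q'}) f q :
  dual_map (hom_map (rmod C) u) (hom_eval f q) = hom_eval f (u q).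
Proof.
apply: additiveP_ext => h.
by rewrite -[RHS]/(dual_fun _ h) hom_evalE /= -[LHS]/(dual_fun _ _) hom_evalE.
Qed.

Lemma bidual_hom_dual (Q : lmodType R^c)
    (beta : {additive dual (hom Q (rmod C)) -> QZ}) :
  exists psi : {linear C^+ -> dualmod Q},
    forall f q, dual_fun (psi f) q = beta (hom_eval f q).
Proof.
have bB f : zmod_morphism (fun q : Q => beta (hom_eval f q)).
  move=> q q'; rewrite -raddfB; congr (beta _); apply: additiveP_ext => h.
  rewrite -[LHS]/(dual_fun _ h).
  rewrite -[RHS]/(dual_fun (hom_eval f q) h - dual_fun (hom_eval f q') h).
  by rewrite !hom_evalE !raddfB.
pose psi f : dualmod Q := projT1 (cid (additive_exists (bB f))).
have psiE f q : dual_fun (psi f) q = beta (hom_eval f q) by rewrite /psi; case: cid.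
have [|g gE] := @linear_exists _ C^+ (dualmod Q) psi.
  move=> r f f'; apply: additiveP_ext => q; rewrite -[LHS]/(dual_fun _ q).
  rewrite -[RHS]/(dual_fun (psi f) ((r : R^c) *: q) + dual_fun (psi f') q).
  rewrite !psiE -raddfD; congr (beta _); apply: additiveP_ext => h.
  rewrite -[LHS]/(dual_fun _ h).
  rewrite -[RHS]/(dual_fun (hom_eval f _) h + dual_fun (hom_eval f' q) h).
  by rewrite !hom_evalE linearZ_LR.
by exists g => f q; rewrite gE.
Qed.

Section DualBasis.
Variables (Q : lmodType R^c) (n : nat) (e : 'I_n -> Q).
Variable (th : 'I_n -> {linear Q -> (R^c)^o}).
Hypothesis Qe : forall q, q = \sum_(i < n) (th i q : R^c) *: e i.

Fact coord_hom_subproof i (c : rmod C) : linear (fun q : Q => (th i q : R^c) *: c).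
Proof. by move=> r q q'; rewrite linearP scalerDl scalerA. Qed.
Let coord_hom i (c : rmod C) : hom Q (rmod C) :=
  projT1 (cid (linear_exists (@coord_hom_subproof i c))).
Let coord_homE i c q : hom_fun (coord_hom i c) q = (th i q : R^c) *: c.
Proof. by rewrite /coord_hom; case: cid => h /= ->. Qed.

Let coord_homB i c c' : coord_hom i (c - c') = coord_hom i c - coord_hom i c'.
Proof.
apply: linearP_ext => q; rewrite -[LHS]/(hom_fun _ q) coord_homE.
rewrite -[RHS]/(hom_fun (coord_hom i c) q - hom_fun (coord_hom i c') q).
by rewrite !coord_homE scalerBr.
Qed.

(* This lemma, [hom_eval_inj] and [bidual_hom_dual] identify Hom(Q, C)^++ with
   Hom_R(C^+, Q^+), for Q finitely generated projective. *)
Lemma hom_eval_surj (psi : {linear C^+ -> dualmod Q}) :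
  exists alpha : {additive dual (hom Q (rmod C)) -> QZ},
    forall f q, dual_fun (psi f) q = alpha (hom_eval f q).
Proof.
have phiB i (Phi : dual (hom Q (rmod C))) :
    zmod_morphism (fun c => dual_fun Phi (coord_hom i c)).
  by move=> c c'; rewrite -raddfB coord_homB.
pose phi i Phi : C^+ := projT1 (cid (additive_exists (phiB i Phi))).
have phiE i Phi c : dual_fun (phi i Phi) c = dual_fun Phi (coord_hom i c).
  by rewrite /phi; case: cid.
have phiD i : zmod_morphism (phi i).
  move=> F G; apply: additiveP_ext => c; rewrite -[LHS]/(dual_fun _ c).
  by rewrite -[RHS]/(dual_fun (phi i F) c - dual_fun (phi i G) c) !phiE.
(* Each Phi is the sum of the [hom_eval (phi i Phi) (e i)], which dictates this value of alpha. *)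
have [|alpha alphaE] := @additive_exists _ QZ
    (fun Phi => \sum_(i < n) dual_fun (psi (phi i Phi)) (e i)).
  move=> F G; rewrite -sumrB; apply: eq_bigr => i _.
  by rewrite phiD linearB.
exists alpha => f q; rewrite alphaE [in LHS](Qe q) raddf_sum; apply: eq_bigr => i _.
rewrite -[LHS]/(dual_fun ((th i q : R) *: psi f) (e i)) -linearZ_LR.
congr (dual_fun (psi _) _); apply: additiveP_ext => c.
by rewrite -[RHS]/(dual_fun _ c) phiE hom_evalE coord_homE.
Qed.

Lemma hom_eval_inj (alpha : {additive dual (hom Q (rmod C)) -> QZ}) :
  (forall f q, alpha (hom_eval f q) = 0) -> forall Phi, alpha Phi = 0.
Proof.
move=> alpha0 Phi.
have phiB i : zmod_morphism (fun c : rmod C => dual_fun Phi (coord_hom i c)).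
  by move=> c c'; rewrite -raddfB coord_homB.
pose phi i : C^+ := projT1 (cid (additive_exists (phiB i))).
have phiE i c : dual_fun (phi i) c = dual_fun Phi (coord_hom i c).
  by rewrite /phi; case: cid.
(* The expansion of h as the sum of the q |-> h(e_i) th_i(q) makes every character a sum of
   evaluations. *)
have -> : Phi = \sum_(i < n) hom_eval (phi i) (e i).
  apply: additiveP_ext => h.
  have sumE (I : finType) (F : I -> dual (hom Q (rmod C))) :
      dual_fun (\sum_i F i) h = \sum_i dual_fun (F i) h.
    by elim/big_rec2: _ => // i y z _ <-.
  rewrite -[LHS]/(dual_fun Phi h) -[RHS]/(dual_fun _ h) sumE.
  have {1}-> : h = \sum_i coord_hom i (hom_fun h (e i)).
    apply: linearP_ext => q.
    have sumE' (I : finType) (F : I -> hom Q (rmod C)) :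
        hom_fun (\sum_i F i) q = \sum_i hom_fun (F i) q.
      by elim/big_rec2: _ => // i y z _ <-.
    rewrite -[RHS]/(hom_fun _ q) sumE' {1}(Qe q) linear_sum.
    by apply: eq_bigr => i _; rewrite linearZ_LR coord_homE.
  by rewrite raddf_sum; apply: eq_bigr => i _; rewrite hom_evalE phiE.
by rewrite raddf_sum big1.
Qed.

End DualBasis.
End Evaluation.

Lemma dualmod_exact (R : pzRingType) (X Y Z : lmodType R^c)
    (u : {linear X -> Y}) (v : {linear Y -> Z}) :
  exact_at u v -> exact_at (dualmod_map v) (dualmod_map u).
Proof.
move=> uv f; split=> [fu|[g <-]].
  have [|g gE] := QZ_extend (v := v) (f := dual_fun f).
    by move=> y /uv[x <-]; rewrite -[LHS]/(dual_fun (dualmod_map u f) x) fu.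
  by exists g; apply: additiveP_ext => y; exact: gE.
apply: additiveP_ext => x; rewrite -[LHS]/(dual_fun g (v (u x))).
by have -> : v (u x) = 0; [apply/uv; exists x|rewrite raddf0].
Qed.

Lemma dualmod_map_inj (R : pzRingType) (X Y : lmodType R^c) (u : {linear X -> Y}) :
  surj u -> injective (dualmod_map u).
Proof.
move=> us f g fg; apply: additiveP_ext => y; have [x <-] := us y.
by rewrite -[LHS]/(dual_fun (dualmod_map u f) x) fg.
Qed.

(** Q^+ is injective: extend the characters a |-> f(a)(e_i) to E_i on B; then h(b)(q), the sum of
    the E_i(th_i(q) b), is R-linear in b. *)
Lemma dualmod_extend (R : pzRingType) (Q : lmodType R^c) (A B : lmodType R)
    (v : {linear A -> B}) (f : {linear A -> dualmod Q}) :
  projective Q -> finitely_generated Q -> (forall a, v a = 0 -> f a = 0) ->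
  exists h : {linear B -> dualmod Q}, forall a, h (v a) = f a.
Proof.
move=> Qp Qf vf; have [n [e [th Qe]]] := fg_dual_basis Qp Qf.
have exE i : exists h : {additive B -> QZ}, forall a, h (v a) = dual_fun (f a) (e i).
  have [|fi fiE] := @additive_exists A QZ (fun a => dual_fun (f a) (e i)).
    by move=> a a'; rewrite linearB.
  have [|h hE] := QZ_extend (v := v) (f := fi); last by exists h => a; rewrite hE fiE.
  by move=> a /vf fa; rewrite fiE fa.
pose E i : {additive B -> QZ} := projT1 (cid (exE i)).
have EE i a : E i (v a) = dual_fun (f a) (e i) by rewrite /E; case: cid.
have hB b : zmod_morphism (fun q : Q => \sum_(i < n) E i ((th i q : R) *: b)).
  move=> q q'; rewrite -sumrB; apply: eq_bigr => i _.
  by rewrite -raddfB -scalerBl linearB.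
pose h b : dualmod Q := projT1 (cid (additive_exists (hB b))).
have hE b q : dual_fun (h b) q = \sum_(i < n) E i ((th i q : R) *: b).
  by rewrite /h; case: cid.
have [|g gE] := @linear_exists R B (dualmod Q) h.
  move=> r b b'; apply: additiveP_ext => q; rewrite -[LHS]/(dual_fun _ q).
  rewrite -[RHS]/(dual_fun (h b) ((r : R^c) *: q) + dual_fun (h b') q).
  rewrite !hE -big_split; apply: eq_bigr => i _ /=.
  by rewrite scalerDr raddfD scalerA linearZ_LR.
exists g => a; rewrite gE; apply: additiveP_ext => q; rewrite -[LHS]/(dual_fun _ q) hE.
rewrite [in RHS](Qe q) -[RHS]/(dual_fun (f a) _) raddf_sum; apply: eq_bigr => i _.
rewrite -linearZ_LR EE linearZ_LR.
by [].
Qed.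

Section CharacterModule.
Variables (S R : pzRingType) (C : bimodType S R).
Local Notation "C ^+" := (dualmod (rmod C)) (at level 2).
Hypothesis C_semidualizing : semidualizing C.
Variable Q : resolution (rmod C).
Hypothesis Q_proj : projective_resolution Q.
Hypothesis Q_fg : forall n, finitely_generated (Q n).

(** Hom_R(C^+, Q^+) is the double dual of Hom(Q, C), which is exact in positive degrees by (c2). *)
Lemma character_hom_exact n (psi : {linear C^+ -> dualmod (Q n.+1)}) :
  (forall f, dualmod_map (res_d Q n.+1) (psi f) = 0) ->
  exists psi' : {linear C^+ -> dualmod (Q n)},
    forall f, psi f = dualmod_map (res_d Q n) (psi' f).
Proof.
move=> psid.
have [? [? [? b1]]] := fg_dual_basis (@Q_proj n.+1) (@Q_fg n.+1).
have [? [? [? b2]]] := fg_dual_basis (@Q_proj n.+2) (@Q_fg n.+2).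
have [alpha alphaE] := hom_eval_surj b1 psi.
have [||beta betaE] := @bidual_exact _ _ _ (hom_map (rmod C) (res_d Q n))
    (hom_map (rmod C) (res_d Q n.+1)) alpha.
- move=> h hd.
  have [|g gE] := semidualizing_c2 C_semidualizing (i := n.+1) isT Q_proj
      (f := hom_fun h).
    by move=> x; rewrite -[LHS]/(hom_fun (hom_map (rmod C) (res_d Q n.+1) h) x) hd.
  by exists g; apply: linearP_ext => x; rewrite -[RHS]/(hom_fun h x) gE.
- apply: (hom_eval_inj b2 (alpha := alpha \o dual_map (hom_map (rmod C) (res_d Q n.+1)))).
  move=> f q; rewrite /= hom_eval_map -alphaE.
  by rewrite -[LHS]/(dual_fun (dualmod_map (res_d Q n.+1) (psi f)) q) psid.
have [psi' psi'E] := bidual_hom_dual beta.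
exists psi' => f; apply: additiveP_ext => q.
rewrite -[LHS]/(dual_fun _ q) alphaE betaE hom_eval_map.
by rewrite -psi'E.
Qed.

(** The value at c (x) f of the comparison map from C (x) C^+ to S^+. *)
Definition scale_eval (f : C^+) (c : C) : dual S :=
  projT1 (cid (@additive_exists S QZ (fun s => dual_fun f (s *: c))
    (fun s t =>
      etrans (congr1 (dual_fun f) (scalerBl s t c)) (raddfB (dual_fun f) _ _)))).

Lemma scale_evalE f c s : dual_fun (scale_eval f c) s = dual_fun f (s *: c).
Proof. by rewrite /scale_eval; case: cid. Qed.

(** The augmentation of the complex Hom(Q, C), with S in the place of End(C_R). *)
Let aug_hom_ex : exists u : {additive S -> hom (Q 0%N) (rmod C)},
  forall s x, hom_fun (u s) x = s *: (res_aug Q x : C).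
Proof.
have [|u uE] := @additive_exists S (hom (Q 0%N) (rmod C))
    (fun s => @lactr S R C s \o res_aug Q : {linear Q 0%N -> rmod C}).
  move=> s t; apply: linearP_ext => x; rewrite -[LHS]/((s - t) *: (res_aug Q x : C)).
  by rewrite scalerBl.
by exists u => s x; rewrite uE.
Qed.
Let aug_hom := projT1 (cid aug_hom_ex).
Let aug_homE s x : hom_fun (aug_hom s) x = s *: (res_aug Q x : C).
Proof. by rewrite /aug_hom; case: cid. Qed.

Let dual_aug_hom f q :
  dual_map aug_hom (hom_eval f q) = scale_eval f (res_aug Q q).
Proof.
apply: additiveP_ext => s; rewrite -[LHS]/(dual_fun (hom_eval f q) (aug_hom s)).
by rewrite hom_evalE aug_homE -[RHS]/(dual_fun _ s) scale_evalE.
Qed.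

(** By (b1), 0 -> S -> Hom(Q_0, C) -> Hom(Q_1, C) is exact. Its double dual identifies S^++ with
    End_R(C^+): exactness in the middle gives surjectivity, exactness at S gives
    [character_end_inj]. *)
Lemma character_end_surj (psi : {linear C^+ -> C^+}) :
  exists alpha : {additive dual S -> QZ},
    forall f c, dual_fun (psi f) c = alpha (scale_eval f c).
Proof.
have [? [? [? b0]]] := fg_dual_basis (@Q_proj 0) (@Q_fg 0).
have [? [? [? b1]]] := fg_dual_basis (@Q_proj 1) (@Q_fg 1).
have [alpha alphaE] := hom_eval_surj b0 (dualmod_map (res_aug Q) \o psi).
have [||beta betaE] := @bidual_exact _ _ _ aug_hom
    (hom_map (rmod C) (res_d Q 0)) alpha.
- move=> h hd.
  have [|g gE] := linear_factor (f := hom_fun h) (@res_aug_surj _ _ Q).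
    move=> x /res_exact0[y <-].
    by rewrite -[LHS]/(hom_fun (hom_map (rmod C) (res_d Q 0) h) y) hd.
  have [k _ kK] := semidualizing_b1 C_semidualizing.
  exists (k g); apply: linearP_ext => x.
  rewrite -[LHS]/(hom_fun (aug_hom (k g)) x) aug_homE.
  by rewrite -[LHS]/(homothetyS C (k g) (res_aug Q x)) kK gE.
- apply: (hom_eval_inj b1 (alpha := alpha \o dual_map (hom_map (rmod C) (res_d Q 0)))).
  move=> f q; rewrite /= hom_eval_map -alphaE.
  by rewrite -[LHS]/(dual_fun (psi f) (res_aug Q (res_d Q 0 q))) res_aug_comp0 raddf0.
exists beta => f c; have [q <-] := @res_aug_surj _ _ Q c.
by rewrite -dual_aug_hom -betaE -alphaE.
Qed.

Lemma character_end_inj (alpha : {additive dual S -> QZ}) :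
  (forall f c, alpha (scale_eval f c) = 0) -> forall phi, alpha phi = 0.
Proof.
move=> alpha0 phi.
have [? [? [? b0]]] := fg_dual_basis (@Q_proj 0) (@Q_fg 0).
have [|Phi PhiE] := QZ_extend (v := aug_hom) (f := dual_fun phi).
  move=> s s0; suff -> : s = 0 by rewrite raddf0.
  apply: (bij_inj (semidualizing_b1 C_semidualizing)); apply: linearP_ext => c.
  have [q <-] := @res_aug_surj _ _ Q c.
  rewrite -[LHS]/(s *: (res_aug Q q : C)) -[RHS]/(0 *: (res_aug Q q : C)) scale0r.
  by rewrite -aug_homE s0.
have -> : phi = dual_map aug_hom Phi.
  by apply: additiveP_ext => s; exact/esym/PhiE.
apply: (hom_eval_inj b0 (alpha := alpha \o dual_map aug_hom)) => f q.
by rewrite /= dual_aug_hom alpha0.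
Qed.

Section Staircase.
Variables (M : lmodType R) (P : resolution M).
Hypothesis P_proj : projective_resolution P.
Hypothesis MQ : forall n (psi : {linear M -> dualmod (Q n.+1)}),
  (forall f, dualmod_map (res_d Q n.+1) (psi f) = 0) ->
  exists psi' : {linear M -> dualmod (Q n)},
    forall f, psi f = dualmod_map (res_d Q n) (psi' f).

(* Diagram chase in the double complex Hom_R(P_j, Q_k^+). *)
Lemma staircase j : forall k (f : {linear P j -> dualmod (Q k.+1)}),
  (forall x, f (res_d P j x) = 0) ->
  (forall x, dualmod_map (res_d Q k.+1) (f x) = 0) ->
  exists g : {linear P j -> dualmod (Q k)},
    (forall x, g (res_d P j x) = 0) /\
    (forall x, dualmod_map (res_d Q k) (g x) = f x).
Proof.
elim: j => [|j IH] k f fd df.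
  (* On P_0 the cocycle descends to M, where [MQ] applies. *)
  have [|psi psiE] := linear_factor (f := f) (@res_aug_surj _ _ P).
    by move=> x /res_exact0[y <-].
  have [|psi' psi'E] := MQ (psi := psi).
    by move=> m; have [x <-] := @res_aug_surj _ _ P m; rewrite psiE.
  exists (psi' \o res_aug P); split=> x /=.
    by rewrite res_aug_comp0 linear0.
  by rewrite -psi'E psiE.
(* Extend f to h on P_j. The induction hypothesis, one column further, gives g with g d = 0 such
   that h - g lifts to e : P_j -> Q_k^+; then e d lifts f. *)
have [|h hE] := dualmod_extend (v := res_d P j) (f := f) (@Q_proj k.+1) (@Q_fg k.+1).
  by move=> x /res_exact[y <-].
have [||g [gd gE]] := IH k.+1 (dualmod_map (res_d Q k.+1) \o h).
- by move=> x /=; rewrite hE.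
- move=> x; apply/(dualmod_exact (@res_exact _ _ Q k.+1)).
  by exists (h x).
have [|e eE] := projective_lift (y := h \- g) (@P_proj j)
    (dualmod_exact (@res_exact _ _ Q k)).
  by move=> x; rewrite linearB /= gE subrr.
exists (e \o res_d P j); split=> x /=; first by rewrite res_d_comp0 linear0.
by have := eE (res_d P j x); rewrite /= gd subr0 hE.
Qed.

(** Inside Q_0^+ the cocycle extends to h on P_i, and [staircase] supplies g with g d = 0 such that
    h - g takes values in C^+. *)
Lemma Ext_character i : hom_cohomology_zero P C^+ i.+1.
Proof.
move=> f fd.
have [|h hE] := dualmod_extend (v := res_d P i) (f := dualmod_map (res_aug Q) \o f)
    (@Q_proj 0) (@Q_fg 0).
  by move=> x /res_exact[y <-]; rewrite /= fd linear0.
have [||g [gd gE]] := @staircase i 0 (dualmod_map (res_d Q 0) \o h).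
- move=> x /=; rewrite hE.
  by apply/(dualmod_exact (@res_exact0 _ _ Q)); exists (f x).
- by move=> x; apply/(dualmod_exact (@res_exact _ _ Q 0)); exists (h x).
have [|e eE] := projective_lift (y := h \- g) (@P_proj i)
    (dualmod_exact (@res_exact0 _ _ Q)).
  by move=> x; rewrite linearB /= gE subrr.
exists e => x; apply: (dualmod_map_inj (@res_aug_surj _ _ Q)).
by have := eE (res_d P i x); rewrite /= gd subr0 hE.
Qed.

End Staircase.

End CharacterModule.

(** * The character module of C lies in the Auslander class *)

Section CharacterAuslander.
Variables (S R : pzRingType) (C : bimodType S R).
Local Notation "C ^+" := (dualmod (rmod C)) (at level 2).

(** An instance of the duality between Tor_i(C, M)^+ and Ext^i(M, C^+). *)
Lemma Tor_zero_of_Ext (M : lmodType R) i :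
  (forall P : resolution M, projective_resolution P ->
    hom_cohomology_zero P C^+ i.+1) -> Tor_zero C i.+1 M.
Proof.
move=> MC P Pp; apply: tensor_exact => [x|psi psid]; first exact: res_d_comp0.
exact: (MC P Pp psi).
Qed.

Hypothesis C_semidualizing : semidualizing C.

Let right_resolution : exists Q : resolution (rmod C),
  projective_resolution Q /\ forall n, finitely_generated (Q n).
Proof. exact: semidualizing_a2 C_semidualizing. Qed.

Let ev : {additive tensor C C^+ -> QZ} :=
  projT1 (cid (tensor_dual_in (idfun : {linear C^+ -> C^+}))).
Let evE c f : ev (tens c f) = dual_fun f c.
Proof. by rewrite /ev; case: cid => e /= ->. Qed.

Let nuB (x : tensor C C^+) : zmod_morphism (fun s : S => ev (s *: x)).
Proof. by move=> s t; rewrite scalerBl raddfB. Qed.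
(** The comparison map from C (x) C^+ to S^+, shown below to be bijective. *)
Let nu (x : tensor C C^+) : dual S := projT1 (cid (additive_exists (nuB x))).
Let nuE x s : dual_fun (nu x) s = ev (s *: x).
Proof. by rewrite /nu; case: cid. Qed.

Let nu_zmod : zmod_morphism nu.
Proof.
move=> x y; apply: additiveP_ext => s; rewrite -[LHS]/(dual_fun _ s).
rewrite -[RHS]/(dual_fun (nu x) s - dual_fun (nu y) s).
by rewrite !nuE scalerBr raddfB.
Qed.

Let nu_tens c f : nu (tens c f) = scale_eval f c.
Proof.
apply: additiveP_ext => s; rewrite -[LHS]/(dual_fun _ s) -[RHS]/(dual_fun _ s).
by rewrite nuE scale_evalE tensZ evE.
Qed.

(** A character of C (x) C^+ is an endomorphism of C^+, hence comes from S^++ and factors through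
    [nu]. *)
Let nu_inj x : nu x = 0 -> x = 0.
Proof.
move=> x0; have [Q [Qp Qf]] := right_resolution.
apply: QZ_separates => chi; have [psi psiE] := tensor_dual_out chi.
have [alpha alphaE] := character_end_surj C_semidualizing Qp Qf psi.
have [nu' nu'E] := additive_exists nu_zmod.
suff -> : chi x = alpha (nu' x) by rewrite nu'E x0 raddf0.
elim/tensor_ind: x {x0} => [|x y IHx IHy|c m]; first by rewrite !raddf0.
  by rewrite !raddfB IHx IHy.
by rewrite nu'E nu_tens -alphaE psiE.
Qed.

Let nu_surj phi : exists x, nu x = phi.
Proof.
have [Q [Qp Qf]] := right_resolution; have [nu' nu'E] := additive_exists nu_zmod.
have [|x <-] := @QZ_separates_image _ _ nu' phi; last by exists x; rewrite nu'E.
move=> alpha alpha0; apply: (character_end_inj C_semidualizing Qp Qf) => f c.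
by rewrite -nu_tens -nu'E.
Qed.

(* C (x) C^+ is the cofree S-module S^+ with counit ev. *)
Let cofree_ex (P : lmodType S) (u : {additive P -> QZ}) :
  exists v : {linear P -> tensor C C^+}, forall p, ev (v p) = u p.
Proof.
have uB p : zmod_morphism (fun s : S => u (s *: p)).
  by move=> s t; rewrite scalerBl raddfB.
pose U p : dual S := projT1 (cid (additive_exists (uB p))).
have UE p s : dual_fun (U p) s = u (s *: p) by rewrite /U; case: cid.
pose v p := projT1 (cid (nu_surj (U p))).
have vE p : nu (v p) = U p by rewrite /v; case: cid.
have evv p s : ev (s *: v p) = u (s *: p) by rewrite -nuE vE UE.
have [|g gE] := @linear_exists S P (tensor C C^+) v.
  move=> s p q; apply/eqP; rewrite -subr_eq0; apply/eqP/nu_inj.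
  apply: additiveP_ext => t; rewrite -[LHS]/(dual_fun _ t) nuE scalerBr raddfB evv.
  by rewrite !scalerDr !scalerA (raddfD u) (raddfD ev) !evv subrr.
by exists g => p; rewrite gE -[v p]scale1r evv scale1r.
Qed.

Let cofree_uniq (P : lmodType S) (v w : {linear P -> tensor C C^+}) :
  (forall p, ev (v p) = ev (w p)) -> forall p, v p = w p.
Proof.
move=> vw p; apply/eqP; rewrite -subr_eq0; apply/eqP/nu_inj.
apply: additiveP_ext => t; rewrite -[LHS]/(dual_fun _ t) nuE scalerBr raddfB.
by rewrite -!linearZ_LR vw subrr.
Qed.

Lemma Auslander_character : Auslander C C^+.
Proof.
have [Q [Qp Qf]] := right_resolution.
split.
- move=> [//|i] _; apply: Tor_zero_of_Ext => P Pp.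
  by apply: (Ext_character Qp Qf Pp) => n psi; exact: character_hom_exact.
(* A cofree module is injective: an additive extension u of ev f lifts to a linear v, and v extends
   f by uniqueness. *)
- move=> [//|i] _ P Pp f fd.
  have [|u uE] := QZ_extend (v := res_d P i) (f := ev \o f).
    by move=> x /res_exact[y <-]; rewrite /= fd raddf0.
  have [v vE] := cofree_ex u; exists v => x.
  apply: (cofree_uniq (w := v \o res_d P i)) => {}x.
  by rewrite /= vE uE.
- have mu_inj : injective (@auslander_mu S R C C^+).
    move=> f g fg; apply: additiveP_ext => c.
    rewrite -[LHS]/(dual_fun f c) -[RHS]/(dual_fun g c) -!evE.
    by rewrite -[tens c f]/(homS_fun (auslander_mu C f) c) fg.
    (* Composition with [ev] inverts mu, as a linear map into a cofree module is determined by its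
       composite with the counit. *)
    have invB (g : homS C (tensor C C^+)) :
        zmod_morphism (fun c : rmod C => ev (homS_fun g c)).
      by move=> c c'; rewrite linearB raddfB.
    pose inv g : C^+ := projT1 (cid (additive_exists (invB g))).
    have invE g c : dual_fun (inv g) c = ev (homS_fun g c) by rewrite /inv; case: cid.
  have invK : cancel inv (@auslander_mu S R C C^+).
    move=> g; apply: linearP_ext; apply: cofree_uniq => c.
    by rewrite -[LHS]/(ev (tens c _)) evE invE.
  by exists inv => // f; apply: mu_inj; rewrite invK.
Qed.

End CharacterAuslander.

(** * Tensoring C with a projective module *)

Section ProjectiveTensor.
Variables (S R : pzRingType) (C : bimodType S R).

(** The map C (x) P -> C (x) R = C induced by a functional on P. *)
Fact tensor_coord_ex (P : lmodType R) (th : {linear P -> R^o}) :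
  exists pi : {linear tensor C P -> C}, forall c p, pi (tens c p) = ract c (th p).
Proof.
pose b (c : C) p := ract c (th p : R).
have bDl c c' m : b (c + c') m = b c m + b c' m by exact: ractDl.
have bDr c m m' : b c (m + m') = b c m + b c m' by rewrite /b linearD ractDr.
have bA c (r : R) m : b (ract c r) m = b c (r *: m) by rewrite /b linearZ_LR ractA.
have bE c p : tensor_lift b (tens c p) = ract c (th p) by rewrite tensor_liftE.
have [g gE] := additive_exists (tensor_liftB bDl bDr bA).
have [|pi piE] := @linear_exists S (tensor C P) C g.
  move=> s x y; rewrite raddfD; congr (_ + _).
  elim/tensor_ind: x => [|x z IHx IHz|c m]; first by rewrite scaler0 raddf0 scaler0.
    by rewrite scalerBr !raddfB /= IHx IHz.
  by rewrite tensZ !gE !bE ractZ.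
by exists pi => c p; rewrite piE gE bE.
Qed.

Variable P : lmodType R.
Hypothesis P_proj : projective P.

Let basis := cid (dual_basis P_proj).
Let th := projT1 basis.
Let th_supp p : exists r : seq P, forall t, th t p != 0 -> t \in r.
Proof. exact: (projT2 basis).1. Qed.
Let th_sum p (r : seq P) : uniq r -> (forall t, th t p != 0 -> t \in r) ->
  p = \sum_(t <- r) (th t p : R) *: t.
Proof. exact: (projT2 basis).2. Qed.

Let pi t : {linear tensor C P -> C} := projT1 (cid (tensor_coord_ex (th t))).
Let piE t c p : pi t (tens c p) = ract c (th t p).
Proof. by rewrite /pi; case: cid. Qed.

Let tensor_expand x : exists r0 : seq P, forall r, uniq r -> {subset r0 <= r} ->
  x = \sum_(t <- r) tens (pi t x) t.
Proof.
elim/tensor_ind: x => [|x y [r rx] [r' ry]|c p].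
- by exists [::] => r _ _; rewrite big1 // => t _; rewrite linear0 tens0l.
- exists (r ++ r') => q uq rq.
  have xq : x = \sum_(t <- q) tens (pi t x) t.
    by apply: rx => // t tr; apply: rq; rewrite mem_cat tr.
  have yq : y = \sum_(t <- q) tens (pi t y) t.
    by apply: ry => // t tr; apply: rq; rewrite mem_cat tr orbT.
  rewrite [LHS](congr2 (fun a b => a - b) xq yq) -sumrB.
  by apply: eq_bigr => t _; rewrite linearB tensBl.
- have [r0 r0P] := th_supp p; exists r0 => r ur r0r.
  rewrite [in LHS](th_sum ur (p := p)) => [|t /r0P/r0r //].
  by rewrite tens_sumr; apply: eq_bigr => t _; rewrite piE tensA.
Qed.

(** The images of the generators of L have a common finite support, so f has only finitely many
    coordinates L -> C. *)
Let fg_expand (L : lmodType S) (f : {linear L -> tensor C P}) :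
  finitely_generated L ->
  exists r : seq P, forall l, f l = \sum_(t <- r) tens (pi t (f l)) t.
Proof.
move=> [n [e eL]].
pose r0 i := projT1 (cid (tensor_expand (f (e i)))).
have r0P i r : uniq r -> {subset r0 i <= r} ->
    f (e i) = \sum_(t <- r) tens (pi t (f (e i))) t.
  by rewrite /r0; case: cid => /= q; apply.
exists (undup (flatten [seq r0 i | i <- enum 'I_n])) => l.
set r := undup _.
have fe i : f (e i) = \sum_(t <- r) tens (pi t (f (e i))) t.
  apply: r0P => [|t tr]; first exact: undup_uniq.
  rewrite mem_undup; apply/flattenP; exists (r0 i) => //.
  by apply: map_f; rewrite mem_enum.
have [a ->] := eL l; rewrite linear_sum.
transitivity (\sum_(i < n) \sum_(t <- r) tens (pi t (a i *: f (e i))) t).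
  apply: eq_bigr => i _; rewrite linearZ_LR {1}(fe i) scaler_sumr.
  by apply: eq_bigr => t _; rewrite tensZ linearZ_LR.
rewrite exchange_big; apply: eq_bigr => t _ /=.
rewrite linear_sum; elim: (index_enum _) => [|i s IH].
  by rewrite !big_nil tens0l.
by rewrite !big_cons tensDl -IH linearZ_LR.
Qed.

Hypothesis C_semidualizing : semidualizing C.

(** The finitely many coordinates of a cocycle are cocycles with values in C, hence coboundaries by
    (c1). *)
Lemma Ext_tensor_projective (L : resolution C) i :
  projective_resolution L -> (forall n, finitely_generated (L n)) ->
  hom_cohomology_zero L (tensor C P) i.+1.
Proof.
move=> Lp Lf f fd; have [r rE] := fg_expand f (Lf i.+1).
have gex t : exists g : {linear L i -> C}, forall x, pi t (f x) = g (res_d L i x).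
  apply: (semidualizing_c1 C_semidualizing (i := i.+1) isT Lp (f := pi t \o f)).
  by move=> x; rewrite /= fd linear0.
pose g t : {linear L i -> C} := projT1 (cid (gex t)).
have gE t x : pi t (f x) = g t (res_d L i x) by rewrite /g; case: cid.
have [|h hE] := @linear_exists S (L i) (tensor C P)
    (fun x => \sum_(t <- r) tens (g t x) t).
  move=> s x y; rewrite scaler_sumr -big_split; apply: eq_bigr => t _ /=.
  by rewrite tensZ -tensDl linearP.
by exists h => x; rewrite rE hE; apply: eq_bigr => t _; rewrite gE.
Qed.

Lemma fg_semidualizing : finitely_generated C.
Proof.
have [L [_ Lf]] := semidualizing_a1 C_semidualizing.
have [n [e eL]] := Lf 0%N; exists n, (fun i => res_aug L (e i)) => c.
have [x <-] := @res_aug_surj _ _ L c; have [a ->] := eL x; exists a.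
by rewrite linear_sum; apply: eq_bigr => i _; rewrite linearZ_LR.
Qed.

(** Every coordinate of p annihilates C, so it is zero by (b2). *)
Lemma mu_projective_inj (p : P) : (forall c : C, tens c p = 0) -> p = 0.
Proof.
move=> cp; rewrite (th_sum (p := p) (r := [::])) ?big_nil // => t /eqP[].
apply: (bij_inj (semidualizing_b2 C_semidualizing)); apply: linearP_ext => c.
rewrite -[LHS]/(ract c _) -[RHS]/(ract c 0) -piE cp linear0.
by apply: (addIr (ract c 0)); rewrite -ractDr !add0r.
Qed.

(** By (b2) each coordinate C -> C of f is right multiplication by an element of R. *)
Lemma mu_projective_surj (f : {linear C -> tensor C P}) :
  exists p, forall c, f c = tens c p.
Proof.
have [r rE] := fg_expand f fg_semidualizing.
have [k _ kK] := semidualizing_b2 C_semidualizing.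
exists (\sum_(t <- r) k (pi t \o f) *: t) => c.
rewrite tens_sumr rE; apply: eq_bigr => t _; rewrite -tensA.
by rewrite -[ract _ _]/(homothetyR C (k (pi t \o f)) c) kK.
Qed.

End ProjectiveTensor.

(** * Cycles of complexes of projective modules *)

Lemma succz_surj n : exists m, n = succz m.
Proof. by exists (n - 1); rewrite succzE subrK. Qed.

Section Cycles.
Variables (R : pzRingType) (X : zcomplex R).
Hypothesis X_exact : zc_exact X.

Definition cycle n := kermod (zc_d X n).
Definition cycle_incl n : {linear cycle n -> X (succz n)} := kermod_incl (zc_d X n).

Lemma cycle_incl_inj n : injective (@cycle_incl n).
Proof. exact: val_inj. Qed.

Lemma cycle_exact n : exact_at (@cycle_incl n) (zc_d X n).
Proof. exact: kermod_exact. Qed.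

Fact cycle_proj_ex n : exists p : {linear X (succz (succz n)) -> cycle n},
  forall x, cycle_incl _ (p x) = zc_d X (succz n) x.
Proof.
apply: linear_corestrict => [|x]; first exact: cycle_incl_inj.
by apply/cycle_exact/X_exact; exists x.
Qed.
Definition cycle_proj n : {linear X (succz (succz n)) -> cycle n} :=
  projT1 (cid (cycle_proj_ex n)).

Lemma cycle_projE n x : cycle_incl _ (cycle_proj n x) = zc_d X (succz n) x.
Proof. by rewrite /cycle_proj; case: cid. Qed.

Lemma cycle_proj_surj n : surj (cycle_proj n).
Proof.
move=> z; have /X_exact[x xz] : zc_d X n (cycle_incl _ z) = 0.
  by apply/cycle_exact; exists z.
by exists x; apply: cycle_incl_inj; rewrite cycle_projE.
Qed.

Lemma cycle_proj_eq0 n x : cycle_proj n x = 0 <-> zc_d X (succz n) x = 0.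
Proof.
split=> [x0|dx]; first by rewrite -cycle_projE x0 linear0.
by apply: cycle_incl_inj; rewrite cycle_projE dx linear0.
Qed.

Lemma cycle_proj_exact n : exact_at (@cycle_incl (succz n)) (cycle_proj n).
Proof. by move=> x; rewrite cycle_proj_eq0; exact: cycle_exact. Qed.

Lemma cycle_proj_exactd n : exact_at (zc_d X (succz (succz n))) (cycle_proj n).
Proof. by move=> x; rewrite cycle_proj_eq0; exact: X_exact. Qed.

(** Z_n sits in X_(n+1) and is the image of X_(n+2), hence the shift by two. *)
Definition cycle_resolution n : resolution (cycle n) :=
  @Resolution R (cycle n) (fun k => X (iter k succz (succz (succz n))))
    (fun k => zc_d X (iter k succz (succz (succz n)))) (cycle_proj n)
    (@cycle_proj_surj n) (@cycle_proj_exactd n)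
    (fun k => @X_exact (iter k succz (succz (succz n)))).

Lemma cycle_extend n (N : lmodType R) (f : {linear cycle n -> N}) :
  zc_hom_exact X N ->
  exists g : {linear X (succz n) -> N}, forall z, g (cycle_incl _ z) = f z.
Proof.
move=> XN; have [+ _] := XN (succz n) (f \o cycle_proj n); case=> [x|g gE].
  by rewrite /= (cycle_proj_exactd _).2 ?linear0 //; exists x.
exists g => z; have [x <-] := cycle_proj_surj z.
by rewrite cycle_projE -gE.
Qed.

(** The identity of Z_n extends to X_(n+1), which makes Z_n a retract of a projective. *)
Lemma cycle_projective n :
  (forall m, projective (X m)) -> zc_hom_exact X (cycle n) -> projective (cycle n).
Proof.
move=> Xp XZ; have [g gE] := cycle_extend idfun XZ.
move=> A B p f ps; have [h hE] := Xp _ _ _ p (f \o g) ps.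
by exists (h \o @cycle_incl n) => z; rewrite /= hE /= gE.
Qed.

Variables (S : pzRingType) (C : bimodType S R).
Local Notation "C ^+" := (dualmod (rmod C)) (at level 2).
Hypothesis C_semidualizing : semidualizing C.
Hypothesis X_proj : forall n, projective (X n).
Hypothesis X_hom : zc_hom_exact X C^+.

Lemma tensor_cycle_inj n : injective (tensor_map C (@cycle_incl n)).
Proof.
apply: raddf_inj => x x0.
(* Injectivity is stated as exactness after a zero map so that [tensor_exact] applies; the condition
   on X makes maps Z_n -> C^+ extend to X_(n+1). *)
have H : exact_at (tensor_map C (\0 : cycle n -> cycle n)) (tensor_map C (@cycle_incl n)).
  apply: tensor_exact => [y|psi _]; first by rewrite linear0.
  by have [g gE] := cycle_extend psi X_hom; exists g.
have [y <-] := (H x).1 x0.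
elim/tensor_ind: y {x x0} => [|y z IHy IHz|c m]; first by rewrite linear0.
  by rewrite linearB /= IHy IHz subrr.
by rewrite /= tensor_mapE tens0r.
Qed.

Lemma tensor_cycle_exact n :
  exact_at (tensor_map C (@cycle_incl (succz n))) (tensor_map C (cycle_proj n)).
Proof.
apply: tensor_exact => [z|psi psi0]; first by apply/cycle_proj_exact; exists z.
have [|g gE] := linear_factor (f := psi) (@cycle_proj_surj n); last by exists g.
by move=> x /cycle_proj_exact[z <-].
Qed.

(** As a map into C (x) X_(n+1), h is c |-> c (x) x. Injectivity of mu on X_n gives d x = 0, so x is
    a cycle. *)
Lemma mu_cycle_surj n (h : {linear C -> tensor C (cycle n)}) :
  exists z, forall c, h c = tens c z.
Proof.
have [x xE] := mu_projective_surj (@X_proj (succz n)) C_semidualizing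
  (tensor_map C (@cycle_incl n) \o h).
have /cycle_exact[z zx] : zc_d X n x = 0.
  apply: (mu_projective_inj (@X_proj n) C_semidualizing) => c.
  rewrite -tensor_mapE -xE /=; apply: tensor_map_comp0 => z.
  by apply/cycle_exact; exists z.
exists z => c; apply: tensor_cycle_inj.
by rewrite tensor_mapE zx -xE.
Qed.

(** Dimension shifting along 0 -> C (x) Z_(m+1) -> C (x) X_(m+2) -> C (x) Z_m -> 0, whose middle
    term has no higher Ext from C. *)
Lemma Ext_tensor_cycle (L : resolution C) i : projective_resolution L ->
  (forall n, finitely_generated (L n)) ->
  forall n, hom_cohomology_zero L (tensor C (cycle n)) i.+1.
Proof.
move=> Lp Lf; elim: i => [|i IH] n f fd; have [m mE] := succz_surj n; subst n.
  have [|g gE] := Ext_tensor_projective (@X_proj _) C_semidualizing Lp Lf (i := 0)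
      (f := tensor_map C (@cycle_incl _) \o f).
    by move=> x; rewrite /= fd linear0.
  (* In degree 1 the projection of g descends to a map h on C, which is c |-> c (x) z. Lifting z to
     x in X_(m+2) gives the correction to g. *)
  have [|h hE] := linear_factor (f := tensor_map C (cycle_proj m) \o g)
      (@res_aug_surj _ _ L).
    move=> x /res_exact0[y <-]; rewrite /= -gE.
    by apply/tensor_cycle_exact; exists (f y).
  have [z zE] := mu_cycle_surj h; have [x xz] := cycle_proj_surj z.
  have [|e eE] := linear_corestrict (y := g \- (tensr x \o res_aug L))
      (@tensor_cycle_inj (succz m)).
    move=> l; apply/tensor_cycle_exact.
    rewrite /= linearB /= -[X in X - _]/((tensor_map C (cycle_proj m) \o g) l).
    by rewrite -hE zE /tensr tensor_mapE xz subrr.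
  exists e => y; apply: tensor_cycle_inj; rewrite eE /= -gE res_aug_comp0.
  by rewrite linear0 subr0.
have [|g gE] := Ext_tensor_projective (@X_proj _) C_semidualizing Lp Lf (i := i.+1)
    (f := tensor_map C (@cycle_incl _) \o f).
  by move=> x; rewrite /= fd linear0.
have [|h hE] := IH m (tensor_map C (cycle_proj m) \o g).
  move=> x; rewrite /= -gE.
  by apply/tensor_cycle_exact; exists (f x).
have [k kE] := Lp i _ _ _ h (tensor_map_surj (C := C) (@cycle_proj_surj m)).
have [|e eE] := linear_corestrict (y := g \- (k \o res_d L i))
    (@tensor_cycle_inj (succz m)).
  move=> l; apply/tensor_cycle_exact.
  by rewrite /= linearB /= kE -hE /= subrr.
exists e => y; apply: tensor_cycle_inj; rewrite eE /= -gE res_d_comp0.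
by rewrite linear0 subr0.
Qed.

Lemma Auslander_cycle n : Auslander C (cycle n).
Proof.
split=> [[//|i] _|[//|i] _|].
(* X itself resolves Z_n, so exactness of Hom(X, C^+) yields Ext^i(Z_n, C^+) = 0 for i >= 1. *)
- apply: Tor_zero_of_Ext; apply: (Ext_zero_resolution (P := cycle_resolution n)).
    by move=> k; exact: X_proj.
  by move=> f fd; have [+ _] := @X_hom (iter i succz (succz (succz n))) f; exact.
- have [L [Lp Lf]] := semidualizing_a1 C_semidualizing.
  by apply: (Ext_zero_resolution Lp); exact: Ext_tensor_cycle.
- have mu_inj : injective (@auslander_mu S R C (cycle n)).
    apply: raddf_inj => z z0; apply: cycle_incl_inj; rewrite linear0.
    apply: (mu_projective_inj (@X_proj (succz n)) C_semidualizing) => c.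
    rewrite -tensor_mapE -[tens c z]/(homS_fun (auslander_mu C z) c) z0.
    exact: linear0.
  pose inv (h : homS C (tensor C (cycle n))) := projT1 (cid (mu_cycle_surj (homS_fun h))).
  have invK : cancel inv (@auslander_mu S R C (cycle n)).
    move=> h; apply: linearP_ext => c; rewrite /inv; case: cid => z zE /=.
    by rewrite -[RHS]/(homS_fun h c) zE.
  by exists inv => // z; apply: mu_inj; rewrite invK.
Qed.

End Cycles.

(** * Projectivity of the modules in GP of the Auslander class *)

Lemma projective_cycle_iso (R : pzRingType) (X : zcomplex R) n (M : lmodType R) :
  is_cycle X n M -> projective (cycle X n) -> projective M.
Proof.
move=> [i [ii iex]] Zp A B p f ps.
have [|j jE] := linear_corestrict (y := i) (@cycle_incl_inj _ X n).
  by move=> x; apply/cycle_exact/iex; exists x.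
have [|k kE] := linear_corestrict (y := @cycle_incl _ X n) ii.
  by move=> z; apply/iex/cycle_exact; exists z.
have [g gE] := Zp _ _ p (f \o k) ps.
exists (g \o j) => x; rewrite /= gE /=; congr (f _); apply: ii.
by rewrite kE jE.
Qed.

(** The Hom-exactness of X is used twice: at C^+, to place the cycles in the Auslander class, and
    then at the cycle itself, to split it off. *)
Lemma GP_Auslander_projective (S R : pzRingType) (C : bimodType S R) (M : lmodType R) :
  semidualizing C -> GP (Auslander C) M -> projective M.
Proof.
move=> hC [X [Xp Xe XN [n XM]]].
apply: (projective_cycle_iso XM); apply: (cycle_projective Xe Xp).
apply/XN/Auslander_cycle => //; exact/XN/Auslander_character.
Qed.

(** * Projective modules belong to GP and have vanishing Ext^1 *)

Section ContractibleComplex.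
Variables (R : pzRingType) (P : lmodType R).

(* P is a cycle of the contractible complex with all terms P * P. *)
Definition shift_map (x : P * P) : P * P := (x.2, 0).
Fact shift_map_is_linear : linear shift_map.
Proof.
by move=> r x y; congr (_, _); rewrite /= scaler0 addr0.
Qed.
HB.instance Definition _ :=
  GRing.isLinear.Build R (P * P)%type (P * P)%type _ shift_map shift_map_is_linear.

Definition shift_complex : zcomplex R :=
  @ZComplex R (fun=> (P * P)%type) (fun=> shift_map).

Lemma projective_pair : projective P -> projective (P * P)%type.
Proof.
move=> Pp A B p f ps.
have [l lE] : exists l : {linear P -> (P * P)%type}, l =1 (fun x => (x, 0)).
  by apply: linear_exists => r x y; congr (_, _); rewrite /= scaler0 addr0.
have [m mE] : exists m : {linear P -> (P * P)%type}, m =1 (fun x => (0, x)).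
  by apply: linear_exists => r x y; congr (_, _); rewrite /= scaler0 addr0.
have [g gE] := Pp _ _ p (f \o l) ps; have [h hE] := Pp _ _ p (f \o m) ps.
have [|k kE] := @linear_exists R (P * P)%type A (fun x => g x.1 + h x.2).
  by move=> r x y; rewrite /= !linearP scalerDr addrACA.
exists k => x; rewrite kE linearD gE hE /= lE mE -linearD.
by congr (f _); case: x => x y; congr (_, _); rewrite /= ?addr0 ?add0r.
Qed.

Lemma projective_GP (A : modclass R) : projective P -> GP A P.
Proof.
move=> Pp; exists shift_complex; split.
- by move=> n; exact: projective_pair.
- by move=> n [x y]; split=> [[->]|[[z w] [<- <-]]] //; exists (0, x).
- move=> N _ n f; split=> [fd|[g gE] x]; last by rewrite gE -(linear0 g).
  (* Since f kills the pairs (y, 0), f (x, y) = f (0, y), and [m] recovers (0, y) from the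
     differential (y, 0). *)
  have [m mE] : exists m : {linear (P * P)%type -> (P * P)%type},
      m =1 (fun x => (0, x.1)).
    by apply: linear_exists => r x y; congr (_, _); rewrite /= scaler0 addr0.
  exists (f \o m) => -[x y]; rewrite /= mE /=.
  apply/eqP; rewrite -subr_eq0 -linearB; apply/eqP; rewrite -(fd (0, x)).
  by congr (f _); congr (_, _); rewrite /= ?subr0 ?subrr.
- exists 0; have [l lE] : exists l : {linear P -> (P * P)%type}, l =1 (fun x => (x, 0)).
    by apply: linear_exists => r x y; congr (_, _); rewrite /= scaler0 addr0.
  exists l; split=> [x y|[x y]]; first by rewrite !lE => -[].
  by split=> [[->]|[z]]; [exists x; rewrite lE|rewrite lE => -[_ <-]].
Qed.

Lemma Ext1_projective (N : lmodType R) : projective P -> Ext_zero 1 P N.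
Proof.
move=> Pp Q Qp f fd.
have [s sE] := Pp _ _ _ (idfun : {linear P -> P}) (@res_aug_surj _ _ Q).
(* With s a section of the augmentation, id - s aug maps Q_0 into im d and is the identity on im d;
   g applies f to a preimage under d. *)
have [||g gE] := linear_through (u := res_d Q 0) (f := f)
    (y := idfun \- (s \o res_aug Q)).
- by move=> x /res_exact[y <-].
- by move=> x; apply/res_exact0; rewrite linearB /= sE subrr.
exists g => x; apply/esym/gE.
by rewrite /= res_aug_comp0 linear0 subr0.
Qed.

End ContractibleComplex.

Theorem theorem3p22 (S R : pzRingType) (C : bimodType S R)
  (C_semidualizing : semidualizing C) :
  ((forall M : lmodType R, Auslander C M -> class_hat (GP (Auslander C)) M) ->
     special_precovering (GP (Auslander C)))
  /\
  ((exists m : nat, class_pd_le (C_injective C) m) ->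
     class_id_finite (Auslander C) ->
     special_precovering (GP (Auslander C))).
Proof.
suff H : special_precovering (GP (Auslander C)) by split.
move=> M; exists (kermod (freecover M)), (freemod R M), (kermod_incl (freecover M)).
exists (freecover M); split.
- exact: val_inj.
- exact: kermod_exact.
- exact: freecover_surj.
- exact/projective_GP/freemod_projective.
- by move=> X' X'GP; apply: Ext1_projective; exact: GP_Auslander_projective X'GP.
Qed.
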